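(* Let $U\in C^{0}(0,1)$. The following are equivalent. (i) $U=U_{f}$ for some $f\in\mathcal{D}_{+}^{2}$. (ii) The Hill equation $\psi''+\tfrac12U\psi=0$ has a positive solution on $(0,1)$. (iii) The Hill equation is disconjugate on $(0,1)$; equivalently, $$\int_{0}^{1}(\chi')^{2}\,dz\ \ge\ \tfrac12\int_{0}^{1}U\chi^{2}\,dz\qquad\text{for all }\chi\in C_{c}^{\infty}(0,1).$$ When these hold, every positive solution $\psi$ and base point $z_{0}\in(0,1)$ determine a law by $$Q(z)=\int_{z_{0}}^{z}\frac{ds}{\psi(s)^{2}},\qquad F=Q^{-1},\qquad f=\psi^{2}\circ F\quad\text{on }J:=Q\big((0,1)\big),$$ and this $f$ has unit total mass automatically; conversely, every law with potential $U$ arises in this way. The set $\mathcal{C}:=\{U:\text{(iii) holds}\}$ is called the probability cone.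
   Context: A law is identified with its probability density. $\mathcal{D}_{+}$ is the set of probability densities on $\mathbb{R}$ that are continuous and strictly positive on an open interval and vanish outside it; $\mathcal{D}_{+}^{2}$ is the subset of those whose density is $C^{2}$ on the interior of the support. For $f\in\mathcal{D}_{+}^{2}$, $F_{f}$ is its distribution function, $Q_{f}=F_{f}^{-1}:(0,1)\to\mathbb{R}$ is its quantile function (which is $C^{3}$), and its rank Hill potential (''potential'' for short) is the Schwarzian derivative $U_{f}(z)=\{Q_{f},z\}=\frac{Q_{f}'''}{Q_{f}'}-\frac32\big(\frac{Q_{f}''}{Q_{f}'}\big)^{2}$ for $z\in(0,1)$. Disconjugacy of the Hill equation on $(0,1)$ means that no nontrivial solution has two zeros in $(0,1)$. The density $f$ given by the reconstruction formula is extended by zero outside $J$.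
   Formalization: The converse is proved up to translation, f(x) = f_{ψ,z0}(x−c), with c = 0 whenever f(0) > 0; literally it fails, since Q(z0)=0 forces 0 ∈ J, excluding e.g. the uniform law on (1,2), whose potential is U=0. *)

(* Defs.v *)
From HB Require Import structures.
From mathcomp Require Import all_boot all_order all_algebra.
From mathcomp Require Import all_classical all_reals all_analysis.

Set Implicit Arguments.
Unset Strict Implicit.
Unset Printing Implicit Defensive.

Import Order.TTheory GRing.Theory Num.Theory.
Import numFieldNormedType.Exports.

Local Open Scope ring_scope.
Local Open Scope classical_set_scope.

(* For open [A] the total derivatives [g^`(j)] at points of [A] only depend on
   [g] on [A]; the values of [g] outside [A] are irrelevant. *)
Definition Ck_on (R : realType) (k : nat) (A : set R) (g : R -> R) : Prop :=
  (forall j, (j < k)%N -> forall x, A x -> derivable g^`(j) x 1) /\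
  (forall j, (j <= k)%N -> {in A, continuous g^`(j)}).

Definition supp (R : realType) (g : R -> R) : set R :=
  closure [set x | g x != 0].

(* Smooth functions on the line with compact support contained in ]0, 1[. *)
Definition test_function (R : realType) (chi : R -> R) : Prop :=
  [/\ forall k, Ck_on k [set: R] chi,
      compact (supp chi) & supp chi `<=` `]0, 1[].

Definition prob_density (R : realType) (f : R -> R) : Prop :=
  [/\ measurable_fun [set: R] f, forall x, 0 <= f x
    & (\int[@lebesgue_measure R]_x (f x)%:E = 1)%E].

(* "Open interval" allows infinite endpoints. *)
Definition Dplus (R : realType) (f : R -> R) : Prop :=
  prob_density f /\
  exists I : set R,
    [/\ open I, is_interval I, {in I, continuous f},
        forall x, I x -> 0 < f x & forall x, ~ I x -> f x = 0].

Definition Dplus2 (R : realType) (f : R -> R) : Prop :=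
  Dplus f /\ Ck_on 2 (supp f)° f.

Definition distr_fun (R : realType) (f : R -> R) (x : R) : R :=
  \int[@lebesgue_measure R]_(t in `]-oo, x]) f t.

(* The inverse of the distribution function, which is injective only on the
   interior of the support. *)
Definition quantile (R : realType) (f : R -> R) : R -> R :=
  'pinv_(cst 0) (supp f)° (distr_fun f).

Definition schwarzian (R : realType) (g : R -> R) (z : R) : R :=
  derive1n 3 g z / derive1 g z
  - 3 / 2 * (derive1n 2 g z / derive1 g z) ^+ 2.

Definition potential (R : realType) (f : R -> R) : R -> R :=
  schwarzian (quantile f).

(* A potential [U] and the solutions are functions on the line of which only
   the values on ]0, 1[ matter. *)
Definition has_potential (R : realType) (f U : R -> R) : Prop :=
  forall z, 0 < z < 1 -> U z = potential f z.

Definition hill_solution (R : realType) (U psi : R -> R) : Prop :=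
  Ck_on 2 `]0, 1[ psi /\
  forall z, 0 < z < 1 -> derive1n 2 psi z + 1 / 2 * U z * psi z = 0.

Definition positive_hill_solution (R : realType) (U psi : R -> R) : Prop :=
  hill_solution U psi /\ forall z, 0 < z < 1 -> 0 < psi z.

Definition disconjugate (R : realType) (U : R -> R) : Prop :=
  forall psi, hill_solution U psi -> (exists2 z, 0 < z < 1 & psi z != 0) ->
  ~ exists a b, [/\ 0 < a < 1, 0 < b < 1, a != b, psi a = 0 & psi b = 0].

Definition hill_form_nonneg (R : realType) (U : R -> R) : Prop :=
  forall chi, test_function chi ->
  \int[@lebesgue_measure R]_(z in `]0, 1[) (derive1 chi z) ^+ 2 >=
  1 / 2 * \int[@lebesgue_measure R]_(z in `]0, 1[) (U z * chi z ^+ 2).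

Definition probability_cone (R : realType) : set (R -> R) :=
  [set U : R -> R | {in `]0, 1[%classic, continuous U} /\ disconjugate U].

Definition oriented_integral (R : realType) (a b : R) (g : R -> R) : R :=
  if a <= b then \int[@lebesgue_measure R]_(s in `[a, b]) g s
  else - \int[@lebesgue_measure R]_(s in `[b, a]) g s.

Definition recQ (R : realType) (psi : R -> R) (z0 z : R) : R :=
  oriented_integral z0 z (fun s => (psi s ^+ 2)^-1).

Definition recJ (R : realType) (psi : R -> R) (z0 : R) : set R :=
  recQ psi z0 @` `]0, 1[.

Definition recF (R : realType) (psi : R -> R) (z0 : R) : R -> R :=
  'pinv_(cst 0) `]0, 1[ (recQ psi z0).

Definition recf (R : realType) (psi : R -> R) (z0 : R) : R -> R :=
  patch (cst 0) (recJ psi z0) (fun x => psi (recF psi z0 x) ^+ 2).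

(* Main.v *)
Require Import Defs.
From HB Require Import structures.
From mathcomp Require Import all_boot all_order all_algebra.
From mathcomp Require Import all_classical all_reals all_analysis.
From mathcomp Require Import measurable_realfun ring lra.
Import Order.TTheory GRing.Theory Num.Theory.
Import numFieldNormedType.Exports.
Local Open Scope ring_scope.
Local Open Scope classical_set_scope.
Set Implicit Arguments.
Unset Strict Implicit.
Unset Printing Implicit Defensive.

(** A positive solution psi of the Hill equation and a law with quantile function
    Q are two descriptions of one object, through Q' = psi ^- 2: the Schwarzian
    derivative of Q is then - 2 psi'' / psi ([schwarzian_inv_sqr]), so that Q has
    Schwarzian derivative U exactly when psi'' + U psi / 2 = 0. From psi to the
    law, the inverse F of Q satisfies F' = psi ^+ 2 \o F = f on J, and F increases
    from 0 to 1 over J, so f has mass one and distribution function F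
    ([recf_mass], [recf_distr], [recf_quantile]). From the law to psi, the
    distribution function maps the interior of the support bijectively onto
    ]0, 1[ ([distr_fun_surj]) and psi is the square root of the density at its
    quantiles ([law_hill_solution]); two quantile functions with the same psi
    differ by a constant, which is the shift in [law_reconstruction].

    The three conditions on U are shown equivalent in a cycle. Disconjugacy gives a
    positive solution ([disconjugate_positive]): in a fundamental system y1, y2,
    constructed by Picard iteration ([linear_system_solution]), a suitable
    combination y1 + s y2 has no zero. A positive solution makes the quadratic form
    nonnegative by Jacobi's completion of the square ([positive_form_nonneg]).

    Finally, nonnegativity of the form on test functions implies disconjugacy
    ([form_nonneg_disconjugate]). A nonzero solution with two zeros changes sign
    twice. Adding to it a small multiple of a steep exponential and approximating
    the sum, up to second derivatives, by a polynomial ([weierstrass]) yields a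
    polynomial V which is negative at a and b, positive somewhere in between, and
    such that V'' + U V / 2 > 0. The functions V exp (- d / V) on {V > 0}, extended
    by zero, are test functions ([flat_sum_test]), and as d tends to 0 the form
    evaluated at them tends to minus the integral of (V'' + U V / 2) max (V, 0),
    which is negative ([form_negative]). *)

(** * Calculus on segments *)

Section Calculus.
Variable R : realType.
Implicit Types (f df g F : R -> R) (a b x y z : R) (A : set R).
Notation mu := (@lebesgue_measure R).

Lemma is_derive_continuous f x l : is_derive x 1 f l -> {for x, continuous f}.
Proof. by move=> [df _]; apply/differentiable_continuous/derivable1_diffP. Qed.

Lemma near_itvoo a b x : a < x < b -> \forall y \near x, a < y < b.
Proof.
move=> axb; have : nbhs x `]a, b[ by apply: open_nbhs_nbhs.
by apply: filterS => y /=; rewrite in_itv.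
Qed.

Lemma near_segment a b x : a < x < b -> \forall y \near x, a <= y <= b.
Proof. by move/near_itvoo; apply: filterS => y /andP[/ltW-> /ltW->]. Qed.

Lemma continuous_within f A :
  (forall x, A x -> {for x, continuous f}) -> {within A, continuous f}.
Proof.
move=> cf; apply: continuous_in_subspaceT => x; rewrite inE; exact: cf.
Qed.

Lemma mean_value f df a b : a < b ->
  (forall x, a <= x <= b -> is_derive x 1 f (df x)) ->
  exists2 c, a < c < b & f b - f a = df c * (b - a).
Proof.
move=> ab fdf; have [] := @MVT R f df a b ab.
- by move=> x; rewrite in_itv/= => /andP[ax xb]; apply: fdf; rewrite !ltW.
- apply: continuous_within => x /=; rewrite in_itv/= => /fdf.
  exact: is_derive_continuous.
- by move=> c; rewrite in_itv/= => cab e; exists c.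
Qed.

Lemma derive_ge0_le f df a b : a <= b ->
  (forall x, a <= x <= b -> is_derive x 1 f (df x)) ->
  (forall x, a <= x <= b -> 0 <= df x) -> f a <= f b.
Proof.
rewrite le_eqVlt => /predU1P[->//|ab] fdf df0.
have [c /andP[ac cb] e] := mean_value ab fdf.
by rewrite -subr_ge0 e mulr_ge0 ?df0 ?subr_ge0 ?ltW.
Qed.

Lemma derive_gt0_lt f df a b : a < b ->
  (forall x, a <= x <= b -> is_derive x 1 f (df x)) ->
  (forall x, a <= x <= b -> 0 < df x) -> f a < f b.
Proof.
move=> ab fdf df0; have [c /andP[ac cb] e] := mean_value ab fdf.
by rewrite -subr_gt0 e mulr_gt0 ?df0 ?subr_gt0 ?ltW.
Qed.

Lemma derive0_cst f A : is_interval A ->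
  (forall x, A x -> is_derive x 1 f 0) ->
  forall x y, A x -> A y -> f x = f y.
Proof.
move=> iA fA; have H x y : A x -> A y -> x < y -> f x = f y.
  move=> Ax Ay xy.
  have [|c _ e] := @mean_value f (cst 0) x y xy.
    by move=> t xty; apply: fA; apply: iA xty.
  by apply/esym/eqP; rewrite -subr_eq0 e mul0r.
move=> x y Ax Ay; case: (ltgtP x y) => [/H->//|/H->//|->//].
Qed.

(** The iterated total derivatives at a point of the open set A depend on f only
    near that point, so that formulas valid on A may be used for them. *)
Lemma Ck_on2I f f1 f2 A : open A ->
  (forall x, A x -> is_derive x 1 f (f1 x)) ->
  (forall x, A x -> is_derive x 1 f1 (f2 x)) ->
  (forall x, A x -> {for x, continuous f2}) ->
  [/\ Ck_on 2 A f, forall x, A x -> derive1 f x = f1 x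
    & forall x, A x -> derive1n 2 f x = f2 x].
Proof.
move=> oA d1 d2 c2.
have e1 x : A x -> f^`() x = f1 x.
  by move=> /d1 dx; rewrite derive1E; apply: derive_val.
have n1 x : A x -> \near x, f1 x = f^`() x.
  move=> Ax; have : nbhs x A by apply: open_nbhs_nbhs.
  by apply: filterS => y /e1.
have d2' x : A x -> is_derive x 1 f^`() (f2 x).
  by move=> Ax; apply: (near_eq_is_derive (n1 _ Ax)); exact: d2.
have e2 x : A x -> f^`(2) x = f2 x.
  by move=> /d2' dx; rewrite derive1nS derive1E; apply: derive_val.
split => //; split.
  case=> [|[|//]] _ x Ax /=; first by have [] := d1 x Ax.
  by have [] := d2' x Ax.
case=> [|[|[|//]]] _ x; rewrite inE => Ax.
- exact: is_derive_continuous (d1 _ Ax).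
- exact: is_derive_continuous (d2' _ Ax).
- rewrite /prop_for /continuous_at e2//.
  apply: cvg_trans (c2 _ Ax); apply: near_eq_cvg.
  have : nbhs x A by apply: open_nbhs_nbhs.
  by apply: filterS => y /e2.
Qed.

Lemma Ck_on2E f A : Ck_on 2 A f ->
  [/\ forall x, A x -> is_derive x 1 f (f^`() x),
      forall x, A x -> is_derive x 1 f^`() (f^`(2) x)
    & forall x, A x -> {for x, continuous f^`(2)}].
Proof.
move=> [d c]; split=> x Ax.
- by rewrite derive1E; apply: derivableP; exact: (d 0%N).
- by rewrite derive1nS derive1E; apply: derivableP; exact: (d 1%N).
- by apply: (c 2%N) => //; rewrite inE.
Qed.

Lemma continuous_integrable f a b :
  (forall x, a <= x <= b -> {for x, continuous f}) ->
  mu.-integrable `[a, b] (EFin \o f).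
Proof.
move=> cf; apply: continuous_compact_integrable; first exact: segment_compact.
by apply: continuous_within => x /=; rewrite in_itv; exact: cf.
Qed.

Lemma Rintegral_derive f F a b : a <= b ->
  (forall x, a <= x <= b -> is_derive x 1 F (f x)) ->
  (forall x, a <= x <= b -> {for x, continuous f}) ->
  \int[mu]_(x in `[a, b]) f x = F b - F a.
Proof.
rewrite le_eqVlt => /predU1P[->|ab] dF cf.
  by rewrite subrr set_itv1 Rintegral_set1.
have cF x : a <= x <= b -> {for x, continuous F}.
  by move/dF; exact: is_derive_continuous.
rewrite /Rintegral (@continuous_FTC2 _ f F)//.
- by apply: continuous_within => x /=; rewrite in_itv/=; exact: cf.
- split.
  + by move=> x; rewrite in_itv/= => /andP[ax xb]; have [] := dF x; rewrite ?ltW.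
  + by apply: cvg_at_right_filter; apply: cF; rewrite lexx ltW.
  + by apply: cvg_at_left_filter; apply: cF; rewrite lexx ltW.
- move=> x; rewrite in_itv/= => /andP[ax xb].
  by rewrite derive1E; have [|_ ->] := dF x; rewrite ?ltW.
Qed.

(** Near z, the oriented integral differs by a constant from an integral whose
    fixed lower bound lies to the left of both z0 and z. *)
Lemma oriented_integral_derive g a b z0 :
  (forall x, a < x < b -> {for x, continuous g}) -> a < z0 < b ->
  forall z, a < z < b -> is_derive z 1 (oriented_integral z0 ^~ g) (g z).
Proof.
move=> cg /andP[az0 z0b] z /andP[az zb].
pose l := (a + Num.min z0 z) / 2; pose u := (b + Num.max z0 z) / 2.
have [al l0 lz u0 [uz ub]] : [/\ a < l, l < z0, l < z, z0 < u & z < u /\ u < b].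
  rewrite /l /u; case: (ltP z0 z) => ?; split; try split; lra.
have ig x y : l <= x -> y <= u -> mu.-integrable `[x, y] (EFin \o g).
  by move=> lx yu; apply: continuous_integrable => t /andP[xt ty]; apply: cg; lra.
have ig' := ig l u (lexx _) (lexx _).
have [dG eG] := @continuous_FTC1_closed R g l z u uz ig' lz (cg z ltac:(lra)).
apply: (@near_eq_is_derive _ _ _
  (fun x => \int[mu]_(t in `[l, x]) g t - \int[mu]_(t in `[l, z0]) g t)); last first.
  rewrite -[g z]subr0; apply: is_deriveB.
  by rewrite -eG derive1E; exact: derivableP.
have /near_itvoo : l < z < u by rewrite lz uz.
apply: filterS => x /andP[lx xu].
have H s t : l < s -> s <= t -> t < u ->
    \int[mu]_(v in `[l, t]) g v - \int[mu]_(v in `[l, s]) g v =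
    \int[mu]_(v in `[s, t]) g v.
  move=> ls st tu; rewrite Rintegral_itvB ?bnd_simp//; last 2 first.
  - by apply: ig; lra.
  - by lra.
  apply: Rintegral_itv_obnd_cbnd; apply: integrableS (ig s t _ _) => //; try lra.
  by apply: subset_itvr; rewrite bnd_simp.
rewrite /oriented_integral; case: leP => h; first by rewrite H.
by rewrite -[in RHS]H ?opprB//; lra.
Qed.

Lemma oriented_integral_refl g z0 : oriented_integral z0 z0 g = 0.
Proof. by rewrite /oriented_integral lexx set_itv1 Rintegral_set1. Qed.

End Calculus.

(** * Differentiation rules and limits under the integral *)

Section Derivation_rules.
Variable R : realType.
Implicit Types (f g : R -> R) (x a b : R).

Lemma is_derive_add f g x a b : is_derive x 1 f a -> is_derive x 1 g b ->
  is_derive x 1 (fun t => f t + g t) (a + b).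
Proof. by move=> ? ?; apply: is_deriveD. Qed.

Lemma is_derive_sub f g x a b : is_derive x 1 f a -> is_derive x 1 g b ->
  is_derive x 1 (fun t => f t - g t) (a - b).
Proof. by move=> ? ?; apply: is_deriveB. Qed.

Lemma is_derive_opp f x a : is_derive x 1 f a ->
  is_derive x 1 (fun t => - f t) (- a).
Proof. by move=> ?; apply: is_deriveN. Qed.

Lemma is_derive_mul f g x a b : is_derive x 1 f a -> is_derive x 1 g b ->
  is_derive x 1 (fun t => f t * g t) (a * g x + f x * b).
Proof.
move=> fa gb; apply: (is_derive_eq (is_deriveM fa gb)).
by rewrite addrC [a * _]mulrC.
Qed.

Lemma is_derive_scale f k x a : is_derive x 1 f a ->
  is_derive x 1 (fun t => k * f t) (k * a).
Proof. by move=> ?; apply: is_deriveZ. Qed.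

Lemma is_derive_cst1 k x : is_derive x 1 (fun=> k : R) 0.
Proof. exact: is_derive_cst. Qed.

Lemma is_derive_id1 x : is_derive x 1 (fun t : R => t) 1.
Proof. exact: is_derive_id. Qed.

Lemma is_derive_exprn f n x a : is_derive x 1 f a ->
  is_derive x 1 (fun t => f t ^+ n.+1) (n.+1%:R * f x ^+ n * a).
Proof.
by move=> fa; rewrite -exprfctE; apply: (is_derive_eq (is_deriveX n.+1 fa)).
Qed.

Lemma is_derive_inv f x a : f x != 0 -> is_derive x 1 f a ->
  is_derive x 1 (fun t => (f t)^-1) (- (f x) ^- 2 * a).
Proof. exact: is_deriveV. Qed.

Lemma is_derive_comp1 f g x a b : is_derive (g x) 1 f a -> is_derive x 1 g b ->
  is_derive x 1 (fun t => f (g t)) (a * b).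
Proof. by move=> ? ?; apply: is_derive1_comp. Qed.

Lemma is_derive_congr f x a b : is_derive x 1 f a -> a = b -> is_derive x 1 f b.
Proof. by move=> ? <-. Qed.

End Derivation_rules.

Section Bounded_limits.
Variable R : realType.
Notation mu := (@lebesgue_measure R).
Implicit Types (a b : R).

(** Dominated convergence, a constant being integrable on a segment. *)
Lemma Rintegral_bounded_cvg (h : nat -> R -> R) (l : R -> R) B a b :
  (forall n, mu.-integrable `[a, b] (EFin \o h n)) ->
  (forall n x, a <= x <= b -> `|h n x| <= B) ->
  (forall x, a <= x <= b -> h ^~ x @ \oo --> l x) ->
  mu.-integrable `[a, b] (EFin \o l) /\
  (fun n => \int[mu]_(x in `[a, b]) h n x) @ \oo -->
    \int[mu]_(x in `[a, b]) l x.
Proof.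
move=> ih hB hl.
have mh n := measurable_int mu (ih n).
have hl' x : `[a, b]%classic x -> (EFin \o h n) x @[n --> \oo] --> (EFin \o l) x.
  by move=> /= /[!in_itv]/= xab; apply: cvg_EFin; [exact: nearW|exact: hl].
have ml := emeasurable_fun_cvg _ _ mh hl'.
have iB : mu.-integrable `[a, b] (EFin \o cst B).
  by apply: continuous_integrable => x _; exact: cvg_cst.
have [| | |il _ cl] := @dominated_convergence _ _ _ mu _ (measurable_itv _)
  (fun n => EFin \o h n) _ (EFin \o cst B) mh ml.
- exact: aeW.
- exact: iB.
- apply: aeW => x n; rewrite /= in_itv/= => xab.
  by rewrite lee_fin hB.
split=> //; apply: fine_cvg; rewrite fineK//.
exact: integrable_fin_num.
Qed.

Lemma oriented_integral_bounded_cvg (h : nat -> R -> R) l B z0 z :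
  let I := fun x => Num.min z0 z <= x <= Num.max z0 z in
  (forall n x, I x -> {for x, continuous (h n)}) ->
  (forall n x, I x -> `|h n x| <= B) ->
  (forall x, I x -> h ^~ x @ \oo --> l x) ->
  (fun n => oriented_integral z0 z (h n)) @ \oo --> oriented_integral z0 z l.
Proof.
move=> I ch hB hl; rewrite /oriented_integral.
case: (leP z0 z) => zz; rewrite {}/I in ch hB hl.
  rewrite (min_idPl zz) (max_idPr zz) in ch hB hl.
  apply: (@Rintegral_bounded_cvg h l B _ _ _ hB hl).2 => n.
  by apply: continuous_integrable => x /ch.
rewrite (min_idPr (ltW zz)) (max_idPl (ltW zz)) in ch hB hl.
apply: cvgN; apply: (@Rintegral_bounded_cvg h l B _ _ _ hB hl).2 => n.
by apply: continuous_integrable => x /ch.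
Qed.

Lemma lipschitz_continuous (f : R -> R) B a b x : a < x < b ->
  (forall s t, a <= s -> s <= t -> t <= b -> `|f t - f s| <= B * (t - s)) ->
  {for x, continuous f}.
Proof.
move=> /andP[ax xb] Lf.
have B0 : 0 <= B.
  have := le_trans (normr_ge0 _) (Lf a b (lexx _) (ltW (lt_trans ax xb)) (lexx _)).
  by rewrite pmulr_lge0// subr_gt0 (lt_trans ax).
apply/cvgrPdist_le => e e0; near=> y.
have /andP[ay yb] : a <= y <= b by near: y; apply: near_segment; rewrite ax.
have : `|x - y| <= e / (B + 1).
  near: y; apply: (@cvgr_dist_le _ _ _ (nbhs x) _ idfun x) => //.
  by rewrite divr_gt0// ltr_wpDl.
have H : `|f x - f y| <= B * `|x - y|.
  case: (leP x y) => xy.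
    by rewrite distrC [`|x - y|]distrC [`|y - x|]ger0_norm ?subr_ge0// Lf// ltW.
  by rewrite [`|x - y|]gtr0_norm ?subr_gt0// Lf// ltW.
move=> xye; apply: (le_trans H).
apply: (@le_trans _ _ ((B + 1) * `|x - y|)); first by rewrite ler_wpM2r// lerDl.
by rewrite mulrC -ler_pdivlMr// ltr_wpDl.
Unshelve. all: by end_near. Qed.

End Bounded_limits.

(** * Picard iteration for linear equations *)

Section Linear_equation.
Variable R : realType.
Implicit Types (f df : R -> R) (a b c x K C : R).

Lemma bounded_on_segment f a b : a <= b ->
  (forall x, a <= x <= b -> {for x, continuous f}) ->
  exists M, forall x, a <= x <= b -> `|f x| <= M.
Proof.
move=> ab cf; have [|c _ fc] := @EVT_max R (fun x => `|f x|) a b ab.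
  apply: continuous_within => x /=; rewrite in_itv/= => /cf cfx.
  exact: (continuous_comp cfx (@norm_continuous _ _ _)).
by exists `|f c| => x xab; apply: fc; rewrite in_itv.
Qed.

(** The right-hand side is the antiderivative, vanishing at c, of the bound on
    the derivative; iterated, this produces the terms of an exponential series. *)
Lemma factorial_growth_right f df C K c x n : c <= x -> f c = 0 ->
  (forall s, c <= s <= x -> is_derive s 1 f (df s)) ->
  (forall s, c <= s <= x -> `|df s| <= C * K * (K * (s - c)) ^+ n / n`!%:R) ->
  `|f x| <= C * (K * (x - c)) ^+ n.+1 / n.+1`!%:R.
Proof.
move=> cx fc0 dfE dfB.
pose G (s : R) : R := C * (K * (s - c)) ^+ n.+1 / n.+1`!%:R.
have dG (s : R) : is_derive s 1 G (C * K * (K * (s - c)) ^+ n / n`!%:R).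
  have H : is_derive s 1 (fun s : R => K * (s - c)) K.
    apply: (is_derive_congr
      (is_derive_scale K (is_derive_sub (is_derive_id1 s) (is_derive_cst1 c s)))).
    by rewrite subr0 mulr1.
  apply: (is_derive_congr
    (is_derive_mul (is_derive_scale C (is_derive_exprn n H)) (is_derive_cst1 _ s))).
  rewrite mulr0 addr0 factS natrM invfM.
  have : n.+1%:R != 0 :> R by rewrite pnatr_eq0.
  have : n`!%:R != 0 :> R by rewrite pnatr_eq0 -lt0n fact_gt0.
  by move: n.+1%:R n`!%:R => u v u0 v0; field; rewrite u0 v0.
have Gc : G c = 0 by rewrite /G subrr mulr0 exprS mul0r mulr0 mul0r.
rewrite ler_norml -/(G x); apply/andP; split.
- have := @derive_ge0_le _ (fun s => G s + f s) _ _ _ cx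
    (fun s hs => is_derive_add (dG s) (dfE s hs)).
  rewrite Gc fc0 addr0 => H; rewrite -subr_ge0 opprK addrC.
  apply: H => s hs; have := dfB s hs; rewrite ler_norml => /andP[+ _].
  by rewrite lerNl -subr_ge0 opprK addrC.
- have := @derive_ge0_le _ (fun s => G s - f s) _ _ _ cx
    (fun s hs => is_derive_sub (dG s) (dfE s hs)).
  rewrite Gc fc0 subr0 subr_ge0; apply=> s hs.
  by rewrite subr_ge0 (le_trans (ler_norm _))// dfB.
Qed.

Lemma factorial_growth f df C K c x n : f c = 0 ->
  (forall s, Num.min c x <= s <= Num.max c x -> is_derive s 1 f (df s)) ->
  (forall s, Num.min c x <= s <= Num.max c x ->
     `|df s| <= C * K * (K * `|s - c|) ^+ n / n`!%:R) ->
  `|f x| <= C * (K * `|x - c|) ^+ n.+1 / n.+1`!%:R.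
Proof.
move=> fc0; case: (leP c x) => cx.
  move=> dfE dfB; rewrite [`|x - c|]ger0_norm ?subr_ge0//.
  apply: (factorial_growth_right cx fc0 dfE) => s hs.
  by have := dfB s hs; rewrite [`|s - c|]ger0_norm ?subr_ge0//; case/andP: hs.
(* The left half follows by reflection through c. *)
move=> dfE dfB; pose g s := f (2 * c - s).
have -> : f x = g (2 * c - x) by congr f; ring.
have -> : `|x - c| = 2 * c - x - c by rewrite ltr0_norm ?subr_lt0//; ring.
apply: (@factorial_growth_right g (fun s => df (2 * c - s) * (- 1))).
- by lra.
- by rewrite /g -[RHS]fc0; congr f; ring.
- move=> s hs; apply: is_derive_comp1; first by apply: dfE; lra.
  apply: (is_derive_congr (is_derive_sub (is_derive_cst1 _ s) (is_derive_id1 s))).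
  by rewrite sub0r.
- move=> s hs; rewrite mulrN1 normrN.
  have -> : s - c = `|2 * c - s - c|.
    by rewrite ler0_norm; [ring|lra].
  by apply: dfB; lra.
Qed.

Lemma cvg_of_exp_increments (u : nat -> R) C K :
  u 0%N = 0 -> 0 <= C -> 0 <= K ->
  (forall n, `|u n.+1 - u n| <= C * K ^+ n / n`!%:R) ->
  cvgn u /\ forall n, `|u n| <= C * expR K.
Proof.
move=> u0 C0 K0 uK.
have uE : u = series (telescope u).
  by apply/funext => n; rewrite [LHS]eq_sum_telescope u0 add0r.
have cC : cvgn (series (fun n => C * K ^+ n / n`!%:R)).
  rewrite [X in cvgn X](_ : _ = fun n => C * series (exp_coeff K) n).
    by apply: is_cvgMr; exact: is_cvg_series_exp_coeff.
  apply/funext => n; rewrite /series/= mulr_sumr.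
  by apply: eq_bigr => i _; rewrite mulrA.
split.
  rewrite uE; apply: normed_cvg.
  apply: series_le_cvg cC => n; [exact: normr_ge0| |exact: uK].
  by rewrite !mulr_ge0 ?exprn_ge0 ?invr_ge0.
move=> n; rewrite uE /series/=; apply: (le_trans (ler_norm_sum _ _ _)).
apply: (@le_trans _ _ (C * series (exp_coeff K) n)).
  rewrite /series/= mulr_sumr; apply: ler_sum => i _.
  by rewrite /exp_coeff/= mulrA uK.
rewrite ler_wpM2l// /expR; apply: nondecreasing_cvgn_le.
  apply/nondecreasing_seqP => m.
  by rewrite seriesSr lerDl exp_coeff_ge0.
exact: is_cvg_series_exp_coeff.
Qed.

Variables (p : R -> R) (y0 z0 : R).
Hypothesis cp : forall x, 0 < x < 1 -> {for x, continuous p}.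

(** The successive approximations of the solution of y' = z, z' = p y with
    value (y0, z0) at 1/2. Starting from (0, 0) makes the first increment the
    constant (y0, z0). *)
Fixpoint picard n : (R -> R) * (R -> R) :=
  if n is m.+1 then
    (fun x => y0 + oriented_integral 2^-1 x (picard m).2,
     fun x => z0 + oriented_integral 2^-1 x (fun s => p s * (picard m).1 s))
  else (cst 0, cst 0).

Let half01 : 0 < (2^-1 : R) < 1. Proof. by lra. Qed.

Lemma picard_derive n x : 0 < x < 1 ->
  is_derive x 1 (picard n.+1).1 ((picard n).2 x) /\
  is_derive x 1 (picard n.+1).2 (p x * (picard n).1 x).
Proof.
pose cont m := forall t : R, 0 < t < 1 ->
  {for t, continuous (picard m).1} /\ {for t, continuous (picard m).2}.
have D m : cont m -> forall t : R, 0 < t < 1 ->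
    is_derive t 1 (picard m.+1).1 ((picard m).2 t) /\
    is_derive t 1 (picard m.+1).2 (p t * (picard m).1 t).
  move=> cm t t01.
  split; rewrite -[X in is_derive _ _ _ X]add0r;
    apply: (is_derive_add (is_derive_cst1 _ _)).
    by apply: oriented_integral_derive t01 => // ? /cm[].
  apply: (oriented_integral_derive (g := fun s => p s * (picard m).1 s)) t01 => //.
  by move=> s s01; apply: continuousM; [exact: cp|have [] := cm s s01].
suff C : cont n by exact: D.
elim: n => [t _|n IH t /(D _ IH)[dy dz]]; first by split; exact: cvg_cst.
by split; [exact: is_derive_continuous dy|exact: is_derive_continuous dz].
Qed.

(** One step integrates the previous increment, after multiplication by p in
    one component; a bound K >= 1 of p serves for both components. *)
Lemma picard_increment a b K : 0 < a -> a <= 2^-1 -> 2^-1 <= b -> b < 1 ->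
  1 <= K -> (forall x, a <= x <= b -> `|p x| <= K) ->
  forall n x, a <= x <= b ->
    `|(picard n.+1).1 x - (picard n).1 x| <=
      (`|y0| + `|z0|) * (K * `|x - 2^-1|) ^+ n / n`!%:R /\
    `|(picard n.+1).2 x - (picard n).2 x| <=
      (`|y0| + `|z0|) * (K * `|x - 2^-1|) ^+ n / n`!%:R.
Proof.
move=> a0 ah hb b1 K1 pK; set C := `|y0| + `|z0|.
have oi0 t (g : R -> R) : g = cst 0 -> oriented_integral 2^-1 t g = 0.
  by move=> ->; rewrite /oriented_integral; case: ifP => _;
    rewrite Rintegral_cst//= mul0r ?oppr0.
elim=> [|n IH] x xab.
  rewrite /= !oi0//; last by apply/funext => s; rewrite mulr0.
  by rewrite expr0 fact0 divr1 mulr1 !addr0 !subr0 lerDl lerDr !normr_ge0.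
have x01 : 0 < x < 1 by lra.
have sab s : Num.min 2^-1 x <= s <= Num.max 2^-1 x -> a <= s <= b.
  by case: (leP 2^-1 x); lra.
have s01 s : a <= s <= b -> 0 < s < 1 by lra.
have B0 s : 0 <= C * (K * `|s - 2^-1|) ^+ n / n`!%:R.
  by rewrite !mulr_ge0 ?exprn_ge0 ?mulr_ge0 ?addr_ge0 ?invr_ge0//; lra.
have sh s : C * K * (K * `|s - 2^-1|) ^+ n / n`!%:R =
    K * (C * (K * `|s - 2^-1|) ^+ n / n`!%:R) by ring.
split.
- apply: (@factorial_growth (fun x => (picard n.+2).1 x - (picard n.+1).1 x)
    (fun x => (picard n.+1).2 x - (picard n).2 x)).
  + by rewrite /= !oriented_integral_refl subrr.
  + move=> s /sab /s01 s1; apply: is_derive_sub (picard_derive n.+1 s1).1 _.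
    exact: (picard_derive n s1).1.
  + move=> s /sab hs; rewrite sh; have [_ h] := IH s hs.
    by apply: (le_trans h); rewrite ler_peMl.
- apply: (@factorial_growth (fun x => (picard n.+2).2 x - (picard n.+1).2 x)
    (fun x => p x * (picard n.+1).1 x - p x * (picard n).1 x)).
  + by rewrite /= !oriented_integral_refl subrr.
  + move=> s /sab /s01 s1; apply: is_derive_sub (picard_derive n.+1 s1).2 _.
    exact: (picard_derive n s1).2.
  + move=> s /sab hs; rewrite sh -mulrBr normrM; have [h _] := IH s hs.
    by rewrite ler_pM// pK.
Qed.

Lemma picard_bounded a b : 0 < a -> a <= 2^-1 -> 2^-1 <= b -> b < 1 ->
  exists B, forall x, a <= x <= b ->
    [/\ cvgn (fun n => (picard n).1 x), cvgn (fun n => (picard n).2 x),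
     forall n, `|(picard n).1 x| <= B,
     forall n, `|(picard n).2 x| <= B & forall n, `|p x * (picard n).1 x| <= B].
Proof.
move=> a0 ah hb b1.
have [||M pM] := @bounded_on_segment p a b; first by lra.
  by move=> x xab; apply: cp; lra.
pose K := Num.max 1 M.
have K1 : 1 <= K by rewrite le_max lexx.
have K0 : 0 <= K by lra.
have pK x : a <= x <= b -> `|p x| <= K.
  by move=> /pM h; rewrite le_max h orbT.
set C := `|y0| + `|z0|.
have C0 : 0 <= C by rewrite addr_ge0.
have inc := picard_increment a0 ah hb b1 K1 pK.
have hx x n : a <= x <= b ->
    C * (K * `|x - 2^-1|) ^+ n / n`!%:R <= C * K ^+ n / n`!%:R.
  move=> xab; rewrite ler_wpM2r ?invr_ge0// ler_wpM2l//.
  have xh : `|x - 2^-1| <= 1 by rewrite ler_norml; lra.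
  by apply: lerXn2r; rewrite ?nnegrE ?mulr_ge0// ler_piMr.
exists (K * (C * expR K)) => x xab.
have [c1 b1'] := @cvg_of_exp_increments (fun n => (picard n).1 x) C K erefl C0 K0
  (fun n => le_trans (inc n x xab).1 (hx x n xab)).
have [c2 b2'] := @cvg_of_exp_increments (fun n => (picard n).2 x) C K erefl C0 K0
  (fun n => le_trans (inc n x xab).2 (hx x n xab)).
have E0 : 0 <= C * expR K by rewrite mulr_ge0// expR_ge0.
split => // n.
- by rewrite (le_trans (b1' n))// ler_peMl.
- by rewrite (le_trans (b2' n))// ler_peMl.
- by rewrite normrM ler_pM// ?pK.
Qed.

(** The approximations converge by comparison with an exponential series, and
    bounded convergence turns the recursion into a pair of integral equations.
    Differentiating these requires the limits to be continuous, which they are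
    because the approximations are Lipschitz uniformly in n near each point. *)
Theorem linear_system_solution : exists y z : R -> R,
  [/\ forall x, 0 < x < 1 -> is_derive x 1 y (z x) /\ is_derive x 1 z (p x * y x),
      y 2^-1 = y0 & z 2^-1 = z0].
Proof.
pose y x := limn (fun n => (picard n).1 x).
pose z x := limn (fun n => (picard n).2 x).
(* [l x, u x] is a segment in ]0, 1[ with 1/2 and x in its interior. *)
pose l x := Num.min 2^-1 x / 2; pose u x := (1 + Num.max 2^-1 x) / 2.
have lu x : 0 < x < 1 ->
    [/\ 0 < l x, l x < 2^-1, 2^-1 < u x, u x < 1 & l x < x < u x].
  by rewrite /l /u; case: (leP 2^-1 x) => ? ?; split; lra.
have bdd x : 0 < x < 1 -> exists B, forall t, l x <= t <= u x ->
    [/\ cvgn (fun n => (picard n).1 t), cvgn (fun n => (picard n).2 t),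
     forall n, `|(picard n).1 t| <= B,
     forall n, `|(picard n).2 t| <= B & forall n, `|p t * (picard n).1 t| <= B].
  by move=> /lu[? ? ? ? _]; apply: picard_bounded => //; exact: ltW.
have cvy x : 0 < x < 1 -> (picard n).1 x @[n --> \oo] --> y x.
  by move=> x01; have [B /(_ x)[]//] := bdd x x01; have [] := lu x x01; lra.
have cvz x : 0 < x < 1 -> (picard n).2 x @[n --> \oo] --> z x.
  by move=> x01; have [B /(_ x)[]//] := bdd x x01; have [] := lu x x01; lra.
have lip (w : R -> R) (v dv : nat -> R -> R) a b B :
    (forall n t, a <= t <= b -> is_derive t 1 (v n) (dv n t)) ->
    (forall n t, a <= t <= b -> `|dv n t| <= B) ->
    (forall t, a <= t <= b -> v n t @[n --> \oo] --> w t) ->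
    forall s t, a <= s -> s <= t -> t <= b -> `|w t - w s| <= B * (t - s).
  move=> dvE dvB vw s t as_ st tb.
  have cw : `|v n t - v n s| @[n --> \oo] --> `|w t - w s|.
    by apply: cvg_norm; apply: cvgB; apply: vw; lra.
  rewrite -(cvg_lim _ cw)//; apply: limr_le; first by apply/cvg_ex; eexists; exact: cw.
  apply: nearW => n; case: (ltgtP s t) st => [st _|//|-> _]; last first.
    by rewrite !subrr normr0 mulr0.
  have [r h|c /andP[sc ct] ->] := @mean_value _ (v n) (dv n) s t st.
    by apply: dvE; lra.
  by rewrite normrM [`|t - s|]gtr0_norm ?subr_gt0// ler_wpM2r ?dvB ?subr_ge0 ?ltW//; lra.
have cy x : 0 < x < 1 -> {for x, continuous y}.
  move=> x01; have [B hB] := bdd x x01; have [l0 _ _ u1 lxu] := lu x x01.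
  apply: (lipschitz_continuous lxu (B := B)).
  apply: (lip y (fun n => (picard n.+1).1) (fun n => (picard n).2)).
  - by move=> n t tlu; have [] := @picard_derive n t; first by lra.
  - by move=> n t /hB[].
  - by move=> t tlu; rewrite (@cvg_shiftS _ (fun n => (picard n).1 t)); apply: cvy; lra.
have cz x : 0 < x < 1 -> {for x, continuous z}.
  move=> x01; have [B hB] := bdd x x01; have [l0 _ _ u1 lxu] := lu x x01.
  apply: (lipschitz_continuous lxu (B := B)).
  apply: (lip z (fun n => (picard n.+1).2) (fun n t => p t * (picard n).1 t)).
  - by move=> n t tlu; have [] := @picard_derive n t; first by lra.
  - by move=> n t /hB[].
  - by move=> t tlu; rewrite (@cvg_shiftS _ (fun n => (picard n).2 t)); apply: cvz; lra.
have cont n t : 0 < t < 1 ->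
    {for t, continuous (picard n).1} /\ {for t, continuous (picard n).2}.
  case: n => [|n] t01; first by split; exact: cvg_cst.
  have [dy dz] := picard_derive n t01.
  by split; [exact: is_derive_continuous dy|exact: is_derive_continuous dz].
have seg x t : 0 < x < 1 -> Num.min 2^-1 x <= t <= Num.max 2^-1 x ->
    l x <= t <= u x /\ 0 < t < 1.
  by rewrite /l /u; case: (leP 2^-1 x) => ? ? ?; split; lra.
have ey x : 0 < x < 1 -> y x = y0 + oriented_integral 2^-1 x z.
  move=> x01; have [B hB] := bdd x x01.
  suff c : (picard n.+1).1 x @[n --> \oo] -->
      y0 + oriented_integral 2^-1 x z.
    rewrite (@cvg_shiftS _ (fun n => (picard n).1 x)) in c.
    exact: (cvg_unique _ (cvy x x01) c).
  apply: cvgD; first exact: cvg_cst.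
  apply: (@oriented_integral_bounded_cvg _ (fun n => (picard n).2) z B).
  - by move=> n t /(seg x t x01)[_ t01]; have [] := cont n t t01.
  - by move=> n t /(seg x t x01)[/hB[]].
  - by move=> t /(seg x t x01)[_]; exact: cvz.
have ez x : 0 < x < 1 -> z x = z0 + oriented_integral 2^-1 x (fun s => p s * y s).
  move=> x01; have [B hB] := bdd x x01.
  suff c : (picard n.+1).2 x @[n --> \oo] -->
      z0 + oriented_integral 2^-1 x (fun s => p s * y s).
    rewrite (@cvg_shiftS _ (fun n => (picard n).2 x)) in c.
    exact: (cvg_unique _ (cvz x x01) c).
  apply: cvgD; first exact: cvg_cst.
  apply: (@oriented_integral_bounded_cvg _ (fun n s => p s * (picard n).1 s) _ B).
  - move=> n t /(seg x t x01)[_ t01]; apply: continuousM; first exact: cp.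
    by have [] := cont n t t01.
  - by move=> n t /(seg x t x01)[/hB[]].
  - by move=> t /(seg x t x01)[_ t01]; apply: cvgMr; exact: cvy.
exists y, z; split; last 2 first.
- by rewrite ey// oriented_integral_refl addr0.
- by rewrite ez// oriented_integral_refl addr0.
move=> x x01; split.
- apply: (@near_eq_is_derive _ _ _ (fun t => y0 + oriented_integral 2^-1 t z)).
    by have := near_itvoo x01; apply: filterS => t /ey.
  rewrite -[z x]add0r; apply: (is_derive_add (is_derive_cst1 _ _)).
  exact: oriented_integral_derive x01.
- apply: (@near_eq_is_derive _ _ _
    (fun t => z0 + oriented_integral 2^-1 t (fun s => p s * y s))).
    by have := near_itvoo x01; apply: filterS => t /ez.
  rewrite -[X in is_derive _ _ _ X]add0r; apply: (is_derive_add (is_derive_cst1 _ _)).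
  apply: (oriented_integral_derive (g := fun s => p s * y s)) x01 => //.
  by move=> t t01; apply: continuousM; [exact: cp|exact: cy].
Qed.

End Linear_equation.

(** * Solutions of the Hill equation *)

Section Signs.
Variable R : realType.
Implicit Types (f : R -> R) (A : set R).

Lemma is_derive_unique f (x a b : R) :
  is_derive x 1 f a -> is_derive x 1 f b -> a = b.
Proof. by move=> [_ <-] [_ <-]. Qed.

Lemma nonvanishing_pos f A : is_interval A ->
  (forall x, A x -> {for x, continuous f}) -> (forall x, A x -> f x != 0) ->
  forall a b, A a -> A b -> 0 < f a -> 0 < f b.
Proof.
move=> iA cf f0 a b Aa Ab fa; rewrite ltNge; apply/negP => fb.
have segA t : Num.min a b <= t <= Num.max a b -> A t.
  by case: (leP a b) => _; exact: iA.
have [|||t] := @IVT R f (Num.min a b) (Num.max a b) 0.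
- by rewrite ge_min le_max lexx.
- by apply: continuous_within => t /=; rewrite in_itv/= => /segA; exact: cf.
- case: (leP a b) => _; rewrite ge_min le_max fb (ltW fa) ?orbT//.
- by rewrite in_itv/= => /segA/f0 /eqP.
Qed.

Lemma increasing_zero_sign f (c l : R) : is_derive c 1 f l -> 0 < l -> f c = 0 ->
  \forall x \near c, (c < x -> 0 < f x) /\ (x < c -> f x < 0).
Proof.
move=> /is_derive1_caratheodory[h [fh ch hc]] l0 fc.
have : \forall x \near c, 0 < h x.
  by apply: (cvgr_gt _ ch); rewrite hc.
apply: filterS => x hx; rewrite fc in fh.
have -> : f x = h x * (x - c) by rewrite -fh subr0.
by split=> ?; rewrite ?pmulr_rgt0 ?pmulr_rlt0 ?subr_gt0 ?subr_lt0.
Qed.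

End Signs.

Section Hill_equation.
Variables (R : realType) (U : R -> R).
Hypothesis cU : forall x, 0 < x < 1 -> {for x, continuous U}.
Implicit Types (y z : R -> R) (a b x : R).

(** The Hill equation as a first order system, so that z is the derivative. *)
Definition hill_pair y z := forall x, 0 < x < 1 ->
  is_derive x 1 y (z x) /\ is_derive x 1 z (- (1 / 2 * U x) * y x).

Let oo01 x : `]0, 1[%classic x <-> 0 < x < 1.
Proof. by rewrite /= in_itv. Qed.

Lemma hill_solution_pair y : hill_solution U y -> hill_pair y y^`().
Proof.
move=> [/Ck_on2E[d1 d2 _] eqn] x x01; split; first exact/d1/oo01.
apply: (is_derive_congr (d2 _ ((oo01 x).2 x01))).
by apply/eqP; rewrite mulNr -addr_eq0 eqn.
Qed.

Lemma pair_hill_solution y z : hill_pair y z -> hill_solution U y.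
Proof.
move=> yz; have [|x /oo01 x01|x /oo01 x01|x /oo01 x01|C _ e2] :=
  @Ck_on2I _ y z (fun x => - (1 / 2 * U x) * y x) `]0, 1[.
- exact: interval_open.
- by have [] := yz x x01.
- by have [] := yz x x01.
- apply: continuousM; last by have [/is_derive_continuous] := yz x x01.
  by apply: continuousN; apply: continuousM; [exact: cvg_cst|exact: cU].
by split => // x x01; rewrite e2 ?oo01// mulNr addNr.
Qed.

Lemma hill_pair_comb y1 z1 y2 z2 (s : R) : hill_pair y1 z1 -> hill_pair y2 z2 ->
  hill_pair (fun x => y1 x + s * y2 x) (fun x => z1 x + s * z2 x).
Proof.
move=> h1 h2 x x01; have [a1 b1] := h1 x x01; have [a2 b2] := h2 x x01.
split; first exact: is_derive_add a1 (is_derive_scale s a2).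
apply: (is_derive_congr (is_derive_add b1 (is_derive_scale s b2))); ring.
Qed.

Lemma wronskian_cst y1 z1 y2 z2 : hill_pair y1 z1 -> hill_pair y2 z2 ->
  forall a b, 0 < a < 1 -> 0 < b < 1 ->
  y1 a * z2 a - z1 a * y2 a = y1 b * z2 b - z1 b * y2 b.
Proof.
move=> h1 h2 a b a01 b01.
apply: (@derive0_cst _ (fun x => y1 x * z2 x - z1 x * y2 x) `]0, 1[);
  rewrite ?oo01//; first exact: interval_is_interval.
move=> x /oo01 x01; have [a1 b1] := h1 x x01; have [a2 b2] := h2 x x01.
apply: (is_derive_congr (is_derive_sub (is_derive_mul a1 b2) (is_derive_mul b1 a2))).
ring.
Qed.

Lemma hill_fundamental_system : exists y1 z1 y2 z2,
  [/\ hill_pair y1 z1, hill_pair y2 z2, y1 2^-1 = 1, y2 2^-1 = 0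
    & forall x, 0 < x < 1 -> y1 x * z2 x - z1 x * y2 x = 1].
Proof.
have cp x : 0 < x < 1 -> {for x, continuous (fun x => - (1 / 2 * U x))}.
  by move=> x01; apply: continuousN; apply: continuousM; [exact: cvg_cst|exact: cU].
have [y1 [z1 [h1 a1 b1]]] := linear_system_solution 1 0 cp.
have [y2 [z2 [h2 a2 b2]]] := linear_system_solution 0 1 cp.
exists y1, z1, y2, z2; split=> // x x01.
rewrite (@wronskian_cst _ _ _ _ h1 h2 x 2^-1)//; last by lra.
by rewrite a1 b1 a2 b2 mulr1 mulr0 subr0.
Qed.

(** Expansion of a solution in the fundamental system: its coefficients are
    Wronskians, which vanish where y and z both do. *)
Lemma hill_unique y z a : hill_pair y z -> 0 < a < 1 -> y a = 0 -> z a = 0 ->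
  forall x, 0 < x < 1 -> y x = 0.
Proof.
move=> h a01 ya za x x01.
have [y1 [z1 [y2 [z2 [h1 h2 _ _ W]]]]] := hill_fundamental_system.
have W1 := wronskian_cst h h1 a01 x01; have W2 := wronskian_cst h h2 a01 x01.
rewrite ya za !mul0r subr0 in W1 W2.
have -> : y x = y1 x * (y x * z2 x - z x * y2 x) - y2 x * (y x * z1 x - z x * y1 x).
  by rewrite -[LHS]mulr1 -(W x x01); ring.
by rewrite -W1 -W2 !mulr0 subr0.
Qed.

(** Let y1, y2 be solutions with values 1, 0 at 1/2 and Wronskian 1. By
    disconjugacy y2 vanishes only at 1/2, and r = - y1 / y2, whose derivative is
    1 / y2 ^+ 2, increases on each side of 1/2. The solution y1 + s y2 vanishes
    where r takes the value s, so disconjugacy forces the values of r on the left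
    to lie above those on the right; at the supremum s of the latter, y1 + s y2
    has no zero. *)
Lemma disconjugate_positive : disconjugate U ->
  exists psi, positive_hill_solution U psi.
Proof.
move=> dis.
have [y1 [z1 [y2 [z2 [h1 h2 y1h y2h W]]]]] := hill_fundamental_system.
have h01 : 0 < (2^-1 : R) < 1 by lra.
have z2h : z2 2^-1 = 1.
  by have := W _ h01; rewrite y1h y2h mul1r mulr0 subr0.
have cont y z : hill_pair y z -> forall x, 0 < x < 1 -> {for x, continuous y}.
  by move=> h x /h[/is_derive_continuous].
have noz y z a b : hill_pair y z -> 0 < a < 1 -> y a != 0 ->
    0 < b < 1 -> y b = 0 -> forall x, 0 < x < 1 -> x != b -> y x != 0.
  move=> h a01 ya b01 yb x x01 xb; apply/eqP => yx.
  by apply: (dis y (pair_hill_solution h)); [exists a|exists x, b].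
have [c c01 y2c] : exists2 c, 0 < c < 1 & y2 c != 0.
  apply: contrapT => H.
  have d0 : is_derive (2^-1 : R) 1 y2 0.
    apply: (@near_eq_is_derive R R R (cst 0)).
    have := near_itvoo h01; apply: filterS => t t01.
    by apply/eqP; rewrite eq_sym; apply/negP => /negP nz; apply: H; exists t.
  have := is_derive_unique (h2 _ h01).1 d0.
  by rewrite z2h => /eqP; rewrite oner_eq0.
have y2n := noz _ _ _ _ h2 c01 y2c h01 y2h.
have [e e0 y2s] : exists2 e, 0 < e & forall x, `|x - 2^-1| < e ->
    (2^-1 < x -> 0 < y2 x) /\ (x < 2^-1 -> y2 x < 0).
  have := increasing_zero_sign (h2 _ h01).1 _ y2h; rewrite z2h => /(_ ltr01).
  move=> /nbhs_ballP[e /= e0 He]; exists e => // x xe.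
  by apply: He; rewrite /ball/= distrC.
have y2p x : 2^-1 < x -> x < 1 -> 0 < y2 x.
  move=> hx x1; pose t := Num.min x (2^-1 + e / 2).
  have [ht tx te] : [/\ 2^-1 < t, t <= x & t < 2^-1 + e].
    by rewrite /t; case: (leP x (2^-1 + e / 2)); split; lra.
  apply: (@nonvanishing_pos _ y2 `[t, x] _ _ _ t x).
  - exact: interval_is_interval.
  - by move=> v; rewrite /= in_itv/= => ?; apply: (cont _ _ h2); lra.
  - by move=> v; rewrite /= in_itv/= => ?; apply: y2n; lra.
  - by rewrite /= in_itv/= lexx.
  - by rewrite /= in_itv/= lexx tx.
  - by apply: (y2s t _).1 => //; rewrite gtr0_norm; lra.
have y2m x : 0 < x -> x < 2^-1 -> y2 x < 0.
  move=> x0 hx; pose t := Num.max x (2^-1 - e / 2).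
  have [ht tx te] : [/\ t < 2^-1, x <= t & 2^-1 - e < t].
    by rewrite /t; case: (leP x (2^-1 - e / 2)); split; lra.
  rewrite -oppr_gt0.
  apply: (@nonvanishing_pos _ (fun x => - y2 x) `[x, t] _ _ _ t x).
  - exact: interval_is_interval.
  - by move=> v; rewrite /= in_itv/= => ?; apply: continuousN; apply: (cont _ _ h2); lra.
  - by move=> v; rewrite /= in_itv/= oppr_eq0 => ?; apply: y2n; lra.
  - by rewrite /= in_itv/= lexx tx.
  - by rewrite /= in_itv/= lexx.
  - by rewrite oppr_gt0; apply: (y2s t _).2 => //; rewrite ltr0_norm; lra.
pose r x := - y1 x / y2 x.
have r_lt a b : a < b -> (forall x, a <= x <= b -> 0 < x < 1 /\ y2 x != 0) ->
    r a < r b.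
  move=> ab Hab; apply: (@derive_gt0_lt _ r (fun x => (y2 x ^+ 2)^-1)) => // x /Hab[x01 nz].
    have [d1 _] := h1 x x01; have [d2 _] := h2 x x01.
    apply: (is_derive_congr (is_derive_mul (is_derive_opp d1) (is_derive_inv nz d2))).
    by rewrite -[RHS]mul1r -(W x x01); field.
  by rewrite invr_gt0 exprn_even_gt0.
have r_sep a b : 0 < a -> a < 2^-1 -> 2^-1 < b -> b < 1 -> r b < r a.
  move=> a0 ah hb b1; have y2b := y2p b hb b1; have y2a := y2m a a0 ah.
  have hw := hill_pair_comb (r b) h1 h2; set w := (fun x => _) in hw.
  have wh : w 2^-1 = 1 by rewrite /w y1h y2h mulr0 addr0.
  have wb : w b = 0 by rewrite /w /r mulfVK ?gt_eqF// subrr.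
  have : 0 < w a.
    apply: (@nonvanishing_pos _ w `[a, 2^-1] _ _ _ 2^-1 a).
    - exact: interval_is_interval.
    - by move=> v; rewrite /= in_itv/= => ?; apply: (cont _ _ hw); lra.
    - by move=> v; rewrite /= in_itv/= => ?; apply: (noz _ _ _ b hw h01) => //; lra.
    - by rewrite /= in_itv/= lexx ltW.
    - by rewrite /= in_itv/= lexx ltW.
    - by rewrite wh.
  by rewrite /w => wa; rewrite [r a]/r ltr_ndivlMr//; lra.
pose E := [set r x | x in `]2^-1, 1[].
have E0 : E !=set0 by exists (r (3 / 4)), (3 / 4) => //=; rewrite in_itv/=; lra.
have Eub a : 0 < a -> a < 2^-1 -> ubound E (r a).
  by move=> a0 ah _ [b /=+ <-]; rewrite in_itv/= => /andP[? ?]; apply/ltW/r_sep.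
have hsE : has_sup E by split => //; exists (r 4^-1); apply: Eub; lra.
exists (fun x => y1 x + sup E * y2 x); split.
  exact: pair_hill_solution (hill_pair_comb (sup E) h1 h2).
move=> x /andP[x0 x1]; case: (ltgtP x 2^-1) => [xh|hx|->].
- have : sup E < r x.
    apply: (@le_lt_trans _ _ (r (x / 2))).
      by apply: ge_sup => //; apply: Eub; lra.
    apply: r_lt; first by lra.
    move=> t tx; split; first by lra.
    by rewrite lt_eqF// y2m//; lra.
  by rewrite /r ltr_ndivlMr ?y2m// => ?; lra.
- have : r x < sup E.
    apply: (@lt_le_trans _ _ (r ((x + 1) / 2))).
      apply: r_lt; first by lra.
      move=> t tx; split; first by lra.
      by rewrite gt_eqF// y2p//; lra.
    apply: sup_ubound; first by case: hsE.
    by exists ((x + 1) / 2) => //=; rewrite in_itv/=; lra.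
  by rewrite /r ltr_pdivrMr ?y2p// => ?; lra.
- by rewrite y1h y2h mulr0 addr0.
Qed.

End Hill_equation.

(** * The quadratic form and positive solutions *)

Section Quadratic_form.
Variables (R : realType) (U : R -> R).
Hypothesis cU : forall x, 0 < x < 1 -> {for x, continuous U}.
Implicit Types (f g chi : R -> R) (a b x : R).
Notation mu := (@lebesgue_measure R).

Lemma Rintegral_oo_segment g a b : 0 < a -> b < 1 ->
  (forall x, ~~ (a <= x <= b) -> g x = 0) ->
  \int[mu]_(x in `]0, 1[) g x = \int[mu]_(x in `[a, b]) g x.
Proof.
move=> a0 b1 g0; rewrite Rintegral_mkcond [RHS]Rintegral_mkcond.
apply: eq_Rintegral => x _; rewrite !patchE !mem_setE !in_itv/=.
case: (boolP (a <= x <= b)) => [xab|/g0->]; last by rewrite if_same.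
by have -> : 0 < x < 1 by lra.
Qed.

Lemma test_function_derive chi : test_function chi ->
  (forall x, is_derive x 1 chi (derive1 chi x)) /\
  (forall x, {for x, continuous (derive1 chi)}).
Proof.
move=> [sm _ _]; have [d c] := sm 1%N; split=> x.
  by rewrite derive1E; apply: derivableP; exact: (d 0%N).
by apply: (c 1%N) => //; rewrite inE.
Qed.

Lemma test_function_support chi : test_function chi ->
  exists a b, [/\ 0 < a, a < b, b < 1
    & forall x, ~~ (a < x < b) -> chi x = 0 /\ derive1 chi x = 0].
Proof.
move=> tchi; have [dchi _] := test_function_derive tchi.
have [_ _ s01] := tchi.
have out c : ~ supp chi c ->
    exists2 e, 0 < e & forall x, `|x - c| < e -> chi x = 0.
  move=> nc; have : nbhs c (~` supp chi).
    by apply: open_nbhs_nbhs; split=> //; exact/closed_openC/closed_closure.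
  move=> /nbhs_ballP[e /= e0 He]; exists e => // x xc.
  apply/eqP/negP => /negP chix; apply: (He x); first by rewrite /ball/= distrC.
  exact: subset_closure.
have [e e0 He] := out 0 (fun h => ltac:(by have := s01 _ h; rewrite /= in_itv/= ltxx)).
have [d d0 Hd] := out 1 (fun h => ltac:(by have := s01 _ h; rewrite /= in_itv/= ltxx andbF)).
pose a := Num.min (e / 2) 3^-1; pose b := Num.max (1 - d / 2) (2 / 3).
have [a0 ae a3] : [/\ 0 < a, a < e & a <= 3^-1].
  by rewrite /a; case: (leP (e / 2) 3^-1); split; lra.
have [b1 bd b3] : [/\ b < 1, 1 - d < b & 2 / 3 <= b].
  by rewrite /b; case: (leP (1 - d / 2) (2 / 3)); split; lra.
have zero x : ~~ (a <= x <= b) -> chi x = 0.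
  move=> xab; case: (boolP (0 < x < 1)) => [x01|nx01].
    move: xab; rewrite negb_and -!ltNge => /orP[xa|bx].
      by apply: He; rewrite subr0 gtr0_norm; lra.
    by apply: Hd; rewrite ltr0_norm; lra.
  apply/eqP/negP => /negP chix.
  have /s01 : supp chi x by exact: subset_closure.
  by rewrite /= in_itv/=; exact/negP.
exists (a / 2), ((1 + b) / 2); split; try lra.
move=> x xab'; have xab : ~~ (a <= x <= b) by lra.
split; first exact: zero.
apply: is_derive_unique (dchi x) _.
apply: (@near_eq_is_derive R R R (cst 0)).
have : nbhs x (~` `[a, b]).
  apply: open_nbhs_nbhs; split; first exact/closed_openC/interval_closed.
  by rewrite /= in_itv/=; exact/negP.
by apply: filterS => y; rewrite /= in_itv/= => /negP/zero.
Qed.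

(** Outside of a segment containing the support both integrands vanish, and
    on that segment all functions are continuous. *)
Lemma form_segment chi a b : test_function chi -> 0 < a -> b < 1 ->
  (forall x, ~~ (a < x < b) -> chi x = 0 /\ derive1 chi x = 0) ->
  \int[mu]_(z in `]0, 1[) (derive1 chi z) ^+ 2
    - 1 / 2 * \int[mu]_(z in `]0, 1[) (U z * chi z ^+ 2) =
  \int[mu]_(z in `[a, b]) (derive1 chi z ^+ 2 - 1 / 2 * (U z * chi z ^+ 2)).
Proof.
move=> tchi a0 b1 out'; have [d c] := test_function_derive tchi.
have out x : ~~ (a <= x <= b) -> chi x = 0 /\ derive1 chi x = 0.
  by move=> xab; apply: out'; lra.
rewrite !(@Rintegral_oo_segment _ a b)//; last 2 first.
- by move=> x /out[->]; rewrite expr0n mulr0.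
- by move=> x /out[_ ->]; rewrite expr0n.
have c1 x : a <= x <= b -> {for x, continuous (fun z => derive1 chi z ^+ 2)}.
  by move=> _; exact: (continuousM (c x) (c x)).
have c2 x : a <= x <= b -> {for x, continuous (fun z => U z * chi z ^+ 2)}.
  move=> xab; apply: continuousM; first by apply: cU; lra.
  by apply: continuousM; exact: is_derive_continuous (d x).
rewrite -RintegralZl//; last exact: continuous_integrable.
rewrite -RintegralB//; first exact: continuous_integrable.
apply: continuous_integrable => x /c2; apply: continuousM; exact: cvg_cst.
Qed.

(** Jacobi's identity: the integrand of the form is
    (chi' - chi psi' / psi) ^+ 2 plus the derivative of chi ^+ 2 psi' / psi. *)
Lemma positive_form_nonneg psi :
  positive_hill_solution U psi -> hill_form_nonneg U.
Proof.
move=> [/hill_solution_pair hp psi0] chi tchi.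
have [a [b [a0 ab b1 out]]] := test_function_support tchi.
rewrite -subr_ge0 (form_segment tchi a0 b1 out).
have [d c] := test_function_derive tchi.
pose q x := chi x ^+ 2 * (derive1 psi x / psi x).
pose dq x := 2 * chi x * derive1 chi x * (derive1 psi x / psi x)
  + chi x ^+ 2 * (- (1 / 2 * U x) - (derive1 psi x / psi x) ^+ 2).
have dqE x : a <= x <= b -> is_derive x 1 q (dq x).
  move=> xab; have x01 : 0 < x < 1 by lra.
  have [p1 p2] := hp x x01; have px : psi x != 0 by rewrite gt_eqF// psi0.
  apply: (is_derive_congr (is_derive_mul (is_derive_exprn 1 (d x))
    (is_derive_mul p2 (is_derive_inv px p1)))).
  by rewrite /dq; field.
have cc x : a <= x <= b -> [/\ {for x, continuous chi}, {for x, continuous (derive1 chi)},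
    {for x, continuous U} & {for x, continuous (fun x => derive1 psi x / psi x)}].
  move=> xab; have x01 : 0 < x < 1 by lra.
  have [p1 p2] := hp x x01; have px : psi x != 0 by rewrite gt_eqF// psi0.
  split => //; [exact: is_derive_continuous (d x)|exact: cU|].
  apply: continuousM; first exact: is_derive_continuous p2.
  by apply: continuousV => //; exact: is_derive_continuous p1.
have cdq x : a <= x <= b -> {for x, continuous dq}.
  move=> /cc[c1 c2 c3 c4]; apply: continuousD.
    apply: continuousM => //; apply: continuousM => //.
    by apply: continuousM => //; exact: cvg_cst.
  apply: continuousM; first exact: (continuousM c1 c1).
  apply: continuousD; last by apply: continuousN; exact: (continuousM c4 c4).
  by apply: continuousN; apply: continuousM => //; exact: cvg_cst.
have qa : q a = 0.
  by rewrite /q (out a _).1 ?expr0n ?mul0r// ltxx.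
have qb : q b = 0.
  by rewrite /q (out b _).1 ?expr0n ?mul0r// ltxx andbF.
have csq x : a <= x <= b ->
    {for x, continuous (fun x => (derive1 chi x - chi x * (derive1 psi x / psi x)) ^+ 2)}.
  move=> /cc[c1 c2 _ c4].
  have c5 := continuousB c2 (continuousM c1 c4).
  exact: (continuousM c5 c5).
rewrite (_ : \int[mu]_(x in _) _ = \int[mu]_(x in `[a, b])
  ((derive1 chi x - chi x * (derive1 psi x / psi x)) ^+ 2 + dq x)); last first.
  by apply: eq_Rintegral => x _; rewrite /dq; ring.
rewrite RintegralD//; [|exact: continuous_integrable..].
rewrite (Rintegral_derive (ltW ab) dqE cdq) qa qb subrr addr0.
by apply: Rintegral_ge0 => x _; exact: sqr_ge0.
Qed.

End Quadratic_form.

(** * Weierstrass approximation *)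

Section Weierstrass.
Variable R : realType.
Implicit Types (f : R -> R) (x e : R) (g h : nat -> R).

Lemma heine f a b e : (forall x, {for x, continuous f}) -> 0 < e ->
  exists2 d, 0 < d & forall x y, a <= x <= b -> `|x - y| < d -> `|f x - f y| < e.
Proof.
move=> cf e0.
have /compact_near_coveringP cov := @segment_compact R a b.
have : \forall d \near 0^'+, `[a, b]%classic `<=`
    (fun x => forall y, `|x - y| < d -> `|f x - f y| < e).
  apply: cov => x _.
  have /cvgrPdist_lt/(_ (e / 2)) := cf x; rewrite divr_gt0// => /(_ isT).
  move=> /nbhs_ballP[r /= r0 Hr].
  exists (ball x (r / 2), `]0, r / 2[%classic) => /=.
    split; first by apply: nbhsx_ballx; rewrite divr_gt0.
    by exists (r / 2) => /=; [rewrite divr_gt0|move=> t /=; rewrite sub0r normrN in_itv/= => ? t0; rewrite t0 -(gtr0_norm t0)].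
  move=> [u d] /= [xu]; rewrite in_itv/= => /andP[d0 dr] y uy.
  have hu : `|f x - f u| < e / 2.
    by apply: Hr; rewrite /ball/= in xu *; lra.
  have hy : `|f x - f y| < e / 2.
    apply: Hr; rewrite /ball/= in xu *.
    have -> : x - y = (x - u) + (u - y) by ring.
    by apply: (le_lt_trans (ler_normD _ _)); lra.
  have -> : f u - f y = (f x - f y) - (f x - f u) by ring.
  by apply: (le_lt_trans (ler_normB _ _)); lra.
move=> [r /= r0 Hr]; exists (r / 2); first by rewrite divr_gt0.
move=> x y xab xy; apply: (Hr (r / 2)) => //=.
- by rewrite sub0r normrN gtr0_norm; lra.
- by rewrite divr_gt0.
Qed.

(** The Bernstein polynomial with node values g 0, ..., g n: the expectation of
    g at the number of successes in n independent trials, conditioned on one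
    trial. *)
Fixpoint bernstein n g : {poly R} :=
  if n is m.+1 then
    (1 - 'X) * bernstein m g + 'X * bernstein m (fun k => g k.+1)
  else (g 0%N)%:P.

Lemma horner_bernsteinS n g x :
  (bernstein n.+1 g).[x] =
  (1 - x) * (bernstein n g).[x] + x * (bernstein n (fun k => g k.+1)).[x].
Proof. by rewrite /= !hornerE. Qed.

Lemma bernstein_le n g h x : 0 <= x <= 1 -> (forall k, (k <= n)%N -> g k <= h k) ->
  (bernstein n g).[x] <= (bernstein n h).[x].
Proof.
move=> /andP[x0 x1]; elim: n g h => [|n IH] g h gh.
  by rewrite !hornerC gh.
rewrite !horner_bernsteinS lerD// ler_wpM2l ?subr_ge0// IH// => k kn; apply: gh => //.
exact: leqW.
Qed.

Lemma bernstein_lin n g h (c d : R) x :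
  (bernstein n (fun k => c * g k + d * h k)).[x] =
  c * (bernstein n g).[x] + d * (bernstein n h).[x].
Proof.
elim: n g h => [|n IH] g h; first by rewrite !hornerC.
by rewrite !horner_bernsteinS !IH; ring.
Qed.

Lemma bernstein_cst n (c : R) x : (bernstein n (fun=> c)).[x] = c.
Proof. by elim: n => [|n IH]; rewrite ?hornerC// horner_bernsteinS IH; ring. Qed.

(** For c = n x this is the variance of a binomial law. *)
Lemma bernstein_variance n (c : R) x :
  (bernstein n (fun k => (k%:R - c) ^+ 2)).[x] =
  n%:R * (x * (1 - x)) + (n%:R * x - c) ^+ 2.
Proof.
elim: n c => [|n IH] c; first by rewrite hornerC; ring.
rewrite horner_bernsteinS IH.
rewrite (_ : (fun k => _) = (fun k : nat => (k%:R - (c - 1)) ^+ 2)); last first.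
  by apply/funext => k; rewrite -natr1; congr (_ ^+ 2); ring.
by rewrite IH -natr1; ring.
Qed.

(** At nodes closer to x than the modulus of continuity f varies by at most
    e / 2; at the other nodes the variation, at most 2 M, is dominated by a
    multiple of the square of the distance to x, whose mean is the variance. *)
Theorem weierstrass f e : (forall x, {for x, continuous f}) -> 0 < e ->
  exists p : {poly R}, forall x, 0 <= x <= 1 -> `|p.[x] - f x| <= e.
Proof.
move=> cf e0.
have [d d0 Hd] := @heine f 0 1 (e / 2) cf ltac:(lra).
have [||M HM] := @bounded_on_segment R f 0 1; [by []|by move=> x _; exact: cf|].
have M0 : 0 <= M by apply: (le_trans (normr_ge0 (f 0))); apply: HM; rewrite lexx ler01.
pose N := (Num.truncn (2 * M / (d ^+ 2 * (e / 2)))).+1.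
have N0 : 0 < N%:R :> R by rewrite ltr0n.
have HN : 2 * M / (d ^+ 2) / N%:R <= e / 2.
  rewrite ler_pdivrMr// -ler_pdivrMl ?divr_gt0// mulrC.
  have -> : 2 * M / d ^+ 2 * (e / 2)^-1 = 2 * M / (d ^+ 2 * (e / 2)).
    by field; rewrite !gt_eqF.
  by rewrite ltW// /N truncnS_gt.
exists (bernstein N (fun k => f (k%:R / N%:R))) => x x01.
pose D k := e / 2 * 1 + 2 * M / d ^+ 2 / N%:R ^+ 2 * (k%:R - N%:R * x) ^+ 2.
have DE : (bernstein N D).[x] <= e.
  rewrite /D (@bernstein_lin N (fun=> 1)) bernstein_cst bernstein_variance subrr.
  rewrite expr0n/= addr0 mulr1.
  apply: (@le_trans _ _ (e / 2 + 2 * M / d ^+ 2 / N%:R)); last by lra.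
  rewrite lerD2l.
  have -> : 2 * M / d ^+ 2 / N%:R ^+ 2 * (N%:R * (x * (1 - x))) =
      (2 * M / d ^+ 2 / N%:R) * (x * (1 - x)).
    by field; rewrite (gt_eqF N0) (gt_eqF d0).
  apply: ler_piMr; last by apply: mulr_ile1; lra.
  by rewrite !mulr_ge0// invr_ge0 ?exprn_ge0// ltW.
have HD k : (k <= N)%N -> `|f (k%:R / N%:R) - f x| <= D k.
  move=> kN; have kN01 : 0 <= (k%:R / N%:R : R) <= 1.
    by rewrite divr_ge0//= ler_pdivrMr// mul1r ler_nat.
  case: (ltP `|x - k%:R / N%:R| d) => [near_|far].
    rewrite distrC; apply: (le_trans (ltW (Hd x _ x01 near_))).
    rewrite /D mulr1 lerDl mulr_ge0 ?sqr_ge0//.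
    by rewrite !mulr_ge0// invr_ge0 exprn_ge0// ltW.
  apply: (@le_trans _ _ (2 * M)).
    apply: (le_trans (ler_normB _ _)); have := HM _ x01; have := HM _ kN01; lra.
  apply: (@le_trans _ _ (2 * M / d ^+ 2 / N%:R ^+ 2 * (k%:R - N%:R * x) ^+ 2)); last first.
    by rewrite /D lerDr mulr1 ltW// divr_gt0.
  have -> : 2 * M / d ^+ 2 / N%:R ^+ 2 * (k%:R - N%:R * x) ^+ 2 =
      2 * M * ((x - k%:R / N%:R) ^+ 2 / d ^+ 2).
    by field; rewrite (gt_eqF N0) (gt_eqF d0).
  rewrite ler_peMr ?mulr_ge0// ler_pdivlMr ?exprn_gt0// mul1r -[leRHS]real_normK ?num_real//.
  by rewrite lerXn2r ?nnegrE// ltW.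
rewrite ler_norml; apply/andP; split.
- rewrite lerBrDr; apply: (@le_trans _ _
    (bernstein N (fun k => 1 * f x + (-1) * D k)).[x]).
    rewrite bernstein_lin bernstein_cst; lra.
  apply: bernstein_le => // k /HD; rewrite ler_norml => /andP[]; lra.
- rewrite lerBlDr; apply: (@le_trans _ _
    (bernstein N (fun k => 1 * f x + 1 * D k)).[x]).
    apply: bernstein_le => // k /HD; rewrite ler_norml => /andP[]; lra.
  rewrite bernstein_lin bernstein_cst; lra.
Qed.

Definition antiderivative (p : {poly R}) : {poly R} :=
  \poly_(i < (size p).+1) (p`_i.-1 / i%:R).

Lemma deriv_antiderivative p : deriv (antiderivative p) = p.
Proof.
apply/polyP => i; rewrite coef_deriv coef_poly ltnS.
case: ltnP => [ip|pi]; last by rewrite mul0rn nth_default.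
by rewrite -[LHS]mulr_natr/= divfK// pnatr_eq0.
Qed.

End Weierstrass.

(** * Smooth functions with compact support *)

Section Flat_functions.
Variable R : realType.
Implicit Types (q p : {poly R}) (d s x y : R).

(** The functions q(1/s) exp (- d / s) extended by 0 to s <= 0; for polynomial q
    they form a class closed under derivation, hence consist of smooth
    functions. *)
Definition flat d q s : R :=
  if 0 < s then q.[s^-1] * expR (- (d / s)) else 0.

Definition flat_deriv d q : {poly R} := 'X^2 * (d%:P * q - deriv q).

Lemma flat_le0 d q s : s <= 0 -> flat d q s = 0.
Proof. by rewrite /flat ltNge => ->. Qed.

(** The power k carries the induction on q: multiplying q by the variable
    raises k by one. *)
Lemma poly_expR_bounded d q k : 0 < d ->
  exists C, forall y, 0 < y -> y ^+ k * `|q.[y]| * expR (- (d * y)) <= C.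
Proof.
move=> d0; elim/poly_ind: q k => [|q c IH] k.
  by exists 0 => y _; rewrite horner0 normr0 mulr0 mul0r.
have [C HC] := IH k.+1.
have [B HB] : exists B, forall y, 0 < y -> y ^+ k * expR (- (d * y)) <= B.
  case: k {IH HC} => [|k].
    exists 1 => y y0; rewrite expr0 mul1r -expR0 ler_expR oppr_le0.
    by rewrite mulr_ge0// ltW.
  exists (k.+1`!%:R / d ^+ k.+1) => y y0.
  have dy : 0 <= d * y by rewrite mulr_ge0// ltW.
  have H : (d * y) ^+ k.+1 / k.+1`!%:R <= expR (d * y).
    by apply: le_trans (expR_ge1Dxn k dy); rewrite lerDr ler01.
  rewrite expRN ler_pdivrMr ?expR_gt0//.
  have k0 : 0 < k.+1`!%:R :> R by rewrite ltr0n fact_gt0.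
  rewrite -ler_pdivrMl ?divr_gt0 ?exprn_gt0//.
  apply: le_trans H.
  rewrite exprMn; move: (exprn_gt0 k.+1 d0) k0.
  move: (d ^+ k.+1) (y ^+ k.+1) k.+1`!%:R => u v w u0 w0.
  by rewrite le_eqVlt; apply/predU1P; left; field; rewrite !gt_eqF.
exists (C + `|c| * B) => y y0; rewrite !hornerE.
have E0 := expR_ge0 (- (d * y)); have yk : 0 <= y ^+ k by rewrite exprn_ge0// ltW.
apply: (@le_trans _ _ (y ^+ k.+1 * `|q.[y]| * expR (- (d * y))
                       + `|c| * (y ^+ k * expR (- (d * y))))); last first.
  by rewrite lerD ?HC// ler_wpM2l// HB.
have -> : y ^+ k.+1 * `|q.[y]| * expR (- (d * y)) + `|c| * (y ^+ k * expR (- (d * y)))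
   = y ^+ k * (`|q.[y]| * y + `|c|) * expR (- (d * y)) by rewrite exprS; ring.
rewrite ler_wpM2r// ler_wpM2l//; apply: (le_trans (ler_normD _ _)).
by rewrite normrM (gtr0_norm y0).
Qed.

(** This makes the derivative at 0 exist and vanish. *)
Lemma flat_quadratic d q : 0 < d -> exists C, forall s, `|flat d q s| <= C * s ^+ 2.
Proof.
move=> d0; have [C HC] := poly_expR_bounded q 2 d0; exists C => s.
have C0 : 0 <= C.
  by apply: le_trans (HC 1 ltr01); rewrite !mulr_ge0 ?expR_ge0 ?exprn_ge0.
rewrite /flat; case: ifPn => [s0|_]; last by rewrite normr0 mulr_ge0// sqr_ge0.
rewrite normrM (ger0_norm (expR_ge0 _)) -ler_pdivrMr ?exprn_gt0//.
apply: le_trans (HC s^-1 _); last by rewrite invr_gt0.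
by rewrite le_eqVlt; apply/predU1P; left; rewrite exprVn; ring.
Qed.

Lemma flat_derive d q s : 0 < d -> is_derive s 1 (flat d q) (flat d (flat_deriv d q) s).
Proof.
move=> d0; case: (ltgtP s 0) => [s0|s0|->].
- rewrite flat_le0 1?ltW//; apply: (@near_eq_is_derive R R R (cst 0)).
  have : s - 1 < s < 0 by lra.
  by move/near_itvoo; apply: filterS => t /andP[_ t0]; rewrite flat_le0// ltW.
- have sn : s != 0 by rewrite gt_eqF.
  apply: (@near_eq_is_derive R R R (fun s => q.[s^-1] * expR (- (d / s)))).
    have : 0 < s < s + 1 by lra.
    by move/near_itvoo; apply: filterS => t /andP[t0 _]; rewrite /flat t0.
  have dV := is_derive_inv sn (is_derive_id1 s).
  have de := is_derive_comp1 (is_derive_expR _) (is_derive_opp (is_derive_scale d dV)).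
  apply: (is_derive_congr (is_derive_mul (is_derive_comp1 (is_derive_poly q _) dV) de)).
  by rewrite /flat s0 /flat_deriv hornerM hornerXn hornerD hornerN hornerM hornerC; field.
- rewrite flat_le0//; have [C HC] := flat_quadratic q d0.
  apply/is_derive1_caratheodory; exists (fun s => flat d q s / s); split.
  + move=> z; rewrite (flat_le0 d q (lexx 0)) !subr0.
    by have [->|z0] := eqVneq z 0; [rewrite flat_le0// mulr0|rewrite divfK].
  + rewrite /prop_for /continuous_at /= invr0 mulr0; apply/cvgrPdist_le => e e0.
    have C0 : 0 <= C by have := HC 1; rewrite expr1n mulr1; exact: le_trans.
    near=> z; rewrite sub0r normrN normrM normfV.
    apply: (@le_trans _ _ (C * `|z|)).
      have [->|z0] := eqVneq z 0; first by rewrite !normr0 invr0 !mulr0.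
      rewrite ler_pdivrMr ?normr_gt0// -mulrA -expr2 real_normK ?num_real//.
    apply: (@le_trans _ _ ((C + 1) * `|z|)); first by rewrite ler_wpM2r// lerDl.
    rewrite mulrC -ler_pdivlMr ?ltr_wpDl//.
    have : - (e / (C + 1)) <= z <= e / (C + 1); last by rewrite ler_norml.
    near: z; apply: near_segment.
    by rewrite oppr_lt0 divr_gt0// ltr_wpDl.
  + by rewrite invr0 mulr0.
Unshelve. all: by end_near. Qed.

Lemma is_derive_horner p x : is_derive x 1 (fun t => p.[t]) (deriv p).[x].
Proof. exact: is_derive_poly. Qed.

(** A cut-off to ]a, b[ of sums of p * flat d q (V). When V is negative at a and
    b the terms vanish near a and b, so that the cut-off is smooth too. *)
Definition flat_sum d (V : {poly R}) a b (l : seq ({poly R} * {poly R})) x : R :=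
  if a < x < b then \sum_(pq <- l) pq.1.[x] * flat d pq.2 V.[x] else 0.

Definition flat_sum_deriv d V (l : seq ({poly R} * {poly R})) :=
  flatten [seq [:: (deriv pq.1, pq.2); (pq.1 * deriv V, flat_deriv d pq.2)] | pq <- l].

Lemma flat_sum_outside d V a b l x : V.[x] < 0 -> flat_sum d V a b l x = 0.
Proof.
move=> V0; rewrite /flat_sum; case: ifP => // _.
by apply: big1 => pq _; rewrite flat_le0 ?mulr0// ltW.
Qed.

Lemma flat_sum_derive d (V : {poly R}) a b l x : 0 < d -> V.[a] < 0 -> V.[b] < 0 ->
  is_derive x 1 (flat_sum d V a b l) (flat_sum d V a b (flat_sum_deriv d V l) x).
Proof.
move=> d0 Va Vb; case: (boolP (a < x < b)) => axb.
  rewrite [X in is_derive _ _ _ X]/flat_sum axb.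
  apply: (@near_eq_is_derive R R R
    (fun x => \sum_(pq <- l) pq.1.[x] * flat d pq.2 V.[x])).
    by have := near_itvoo axb; apply: filterS => t; rewrite /flat_sum => ->.
  rewrite big_flatten big_map.
  elim: l => [|pq l IH].
    rewrite big_nil (_ : (fun _ => _) = cst 0); first exact: is_derive_cst.
    by apply/funext => t; rewrite big_nil.
  rewrite big_cons (_ : (fun _ => _) = fun t =>
    pq.1.[t] * flat d pq.2 V.[t] + \sum_(pq <- l) pq.1.[t] * flat d pq.2 V.[t]); last first.
    by apply/funext => t; rewrite big_cons.
  apply: is_derive_add IH.
  apply: (is_derive_congr (is_derive_mul (is_derive_horner pq.1 x)
    (is_derive_comp1 (flat_derive pq.2 _ d0) (is_derive_horner V x)))).
  by rewrite !big_cons big_nil /= addr0 hornerM; ring.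
rewrite [X in is_derive _ _ _ X]/flat_sum (negbTE axb).
apply: (@near_eq_is_derive R R R (cst 0)).
have cV : {for x, continuous (fun t => V.[t])}.
  exact: is_derive_continuous (is_derive_horner V x).
have [Vx|Vx] := ltP V.[x] 0.
  have nV : \forall t \near x, V.[t] < 0 by exact: (cvgr_lt _ cV).
  by apply: filterS nV => t Vt; rewrite flat_sum_outside.
have : x < a \/ b < x.
  move: axb; rewrite negb_and -!leNgt !le_eqVlt.
  case/orP=> /predU1P[xE|xE]; [|by left| |by right].
    by move: Vx; rewrite xE leNgt Va.
  by move: Vx; rewrite -xE leNgt Vb.
case=> h.
- have : x - 1 < x < a by lra.
  move/near_itvoo; apply: filterS => t /andP[_ ta].
  by rewrite /flat_sum ltNge (ltW ta).
- have : b < x < x + 1 by lra.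
  move/near_itvoo; apply: filterS => t /andP[bt _].
  by rewrite /flat_sum andbC ltNge (ltW bt).
Qed.

Lemma flat_sum_test d (V : {poly R}) a b l : 0 < d -> V.[a] < 0 -> V.[b] < 0 ->
  0 < a -> b < 1 -> test_function (flat_sum d V a b l).
Proof.
move=> d0 Va Vb a0 b1.
have supS : supp (flat_sum d V a b l) `<=` `[a, b].
  have /closure_id -> : closed (`[a, b]%classic : set R) by exact: interval_closed.
  apply: closure_subset => x /=; rewrite /flat_sum in_itv/=.
  by case: ifP => [/andP[ax xb] _|]; rewrite ?eqxx// !ltW.
split.
- have D j m : exists m', derive1n j (flat_sum d V a b m) = flat_sum d V a b m'.
    elim: j m => [|j IH] m; first by exists m.
    rewrite derive1Sn (_ : derive1 _ = flat_sum d V a b (flat_sum_deriv d V m)).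
      exact: IH.
    apply/funext => x; rewrite derive1E.
    by have [_ ->] := @flat_sum_derive d V a b m x d0 Va Vb.
  move=> k; split=> j _ x _; have [m ->] := D j l.
    by have [] := @flat_sum_derive d V a b m x d0 Va Vb.
  exact: is_derive_continuous (@flat_sum_derive d V a b m x d0 Va Vb).
- apply: (subclosed_compact _ (@segment_compact _ a b)) => //.
  exact: closed_closure.
- move=> x /supS; rewrite /= !in_itv/= => /andP[ax xb].
  by rewrite (lt_le_trans a0 ax) (le_lt_trans xb b1).
Qed.

End Flat_functions.

(** * Test functions with negative form *)

Section Form_to_disconjugacy.
Variables (R : realType) (U : R -> R).
Hypothesis cU : forall x, 0 < x < 1 -> {for x, continuous U}.
Implicit Types (f k : R -> R) (a b c d x : R) (V : {poly R}).
Notation mu := (@lebesgue_measure R).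

Lemma near_right a b (P : R -> Prop) : a < b -> (\forall x \near a, P x) ->
  exists x, [/\ a < x, x < b & P x].
Proof.
move=> ab /nbhs_ballP[e /= e0 He]; pose x := Num.min ((a + b) / 2) (a + e / 2).
have [ax xb xe] : [/\ a < x, x < b & x < a + e].
  by rewrite /x; case: (leP ((a + b) / 2) (a + e / 2)); split; lra.
by exists x; split=> //; apply: He; rewrite /ball/= ltr0_norm; lra.
Qed.

Lemma near_left a b (P : R -> Prop) : b < a -> (\forall x \near a, P x) ->
  exists x, [/\ b < x, x < a & P x].
Proof.
move=> ab /nbhs_ballP[e /= e0 He]; pose x := Num.max ((a + b) / 2) (a - e / 2).
have [ax xb xe] : [/\ x < a, b < x & a - e < x].
  by rewrite /x; case: (leP ((a + b) / 2) (a - e / 2)); split; lra.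
by exists x; split=> //; apply: He; rewrite /ball/= gtr0_norm; lra.
Qed.

Lemma Rintegral_gt0 k a b c : 0 < a -> b < 1 -> a < c < b ->
  (forall x, 0 < x < 1 -> {for x, continuous k}) ->
  (forall x, a <= x <= b -> 0 <= k x) -> 0 < k c ->
  0 < \int[mu]_(x in `[a, b]) k x.
Proof.
move=> a0 b1 /andP[ac cb] ck k0 kc.
pose A x := oriented_integral c x k.
have dA x : 0 < x < 1 -> is_derive x 1 A (k x).
  by apply: oriented_integral_derive => //; lra.
have c01 : 0 < c < 1 by lra.
have Ac : A c = 0 by exact: oriented_integral_refl.
have [x [cx xb [Ax _]]] := near_right cb (increasing_zero_sign (dA c c01) kc Ac).
have Aab : A a <= A c.
  by apply: (@derive_ge0_le _ A k); [exact: ltW|move=> t ?; apply: dA; lra|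
    move=> t ?; apply: k0; lra].
have Axb : A x <= A b.
  by apply: (@derive_ge0_le _ A k); [exact: ltW|move=> t ?; apply: dA; lra|
    move=> t ?; apply: k0; lra].
have -> : \int[mu]_(x in `[a, b]) k x = A b - A a.
  by apply: Rintegral_derive => [|t ?|t ?]; [|apply: dA|apply: ck]; lra.
by have := Ax cx; rewrite Ac in Aab; lra.
Qed.

(** The test functions are G(V) with G s = s exp (- d / s) for s > 0.  With
    H s = G s ^+ 2 / s, subtracting the derivative of V' H(V) from the integrand
    leaves V'^2 (G' - G / s)^2 (V) - (V'' + U V / 2) H(V), whose first term
    vanishes and whose second term tends to - (V'' + U V / 2) V as d tends to 0. *)
Lemma form_negative V a b c : 0 < a -> b < 1 -> a < c < b ->
  V.[a] < 0 -> 0 < V.[c] -> V.[b] < 0 ->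
  (forall x, a <= x <= b -> 0 < (deriv (deriv V)).[x] + 1 / 2 * U x * V.[x]) ->
  ~ hill_form_nonneg U.
Proof.
move=> a0 b1 acb Va Vc Vb gpos pos.
have ab : a <= b by lra.
pose g x := (deriv (deriv V)).[x] + 1 / 2 * U x * V.[x].
pose V' := deriv V.
have cp (p : {poly R}) x : {for x, continuous (fun t => p.[t])}.
  exact: is_derive_continuous (is_derive_horner p x).
have cg x : 0 < x < 1 -> {for x, continuous g}.
  move=> x01; apply: continuousD; first exact: cp.
  apply: continuousM; last exact: cp.
  by apply: continuousM; [exact: cvg_cst|exact: cU].
pose d (n : nat) : R := n.+1%:R^-1.
have d0 n : 0 < d n by rewrite invr_gt0 ltr0n.
have d20 n : 0 < 2 * d n by rewrite mulr_gt0.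
pose chi n := flat_sum (d n) V a b [:: (V, 1)].
have tchi n : test_function (chi n) by exact: flat_sum_test.
have chiE n x : a <= x <= b -> chi n x = V.[x] * flat (d n) 1 V.[x].
  move=> xab; rewrite /chi /flat_sum big_seq1 /=; case: ifPn => // nx.
  have [->|->] : x = a \/ x = b.
    by move: nx; rewrite negb_and -!leNgt => /orP[?|?]; [left|right];
      apply/eqP; rewrite eq_le; lra.
  - by rewrite flat_le0 ?mulr0// ltW.
  - by rewrite flat_le0 ?mulr0// ltW.
have dchiE n x : a <= x <= b -> derive1 (chi n) x =
    V'.[x] * flat (d n) 1 V.[x] + V.[x] * V'.[x] * flat (d n) (flat_deriv (d n) 1) V.[x].
  move=> xab; rewrite derive1E.
  have [_ ->] := @flat_sum_derive _ (d n) V a b [:: (V, 1)] x (d0 n) Va Vb.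
  rewrite /flat_sum !big_cons big_nil /= addr0 hornerM; case: ifPn => // nx.
  have [->|->] : x = a \/ x = b.
    by move: nx; rewrite negb_and -!leNgt => /orP[?|?]; [left|right];
      apply/eqP; rewrite eq_le; lra.
  - by rewrite !flat_le0 ?mulr0 ?addr0// ltW.
  - by rewrite !flat_le0 ?mulr0 ?addr0// ltW.
have out n x : ~~ (a < x < b) -> chi n x = 0 /\ derive1 (chi n) x = 0.
  move=> xab; rewrite derive1E.
  have [_ ->] := @flat_sum_derive _ (d n) V a b [:: (V, 1)] x (d0 n) Va Vb.
  by rewrite /chi /flat_sum (negbTE xab).
(* K is V' H(V), which vanishes at a and b. *)
pose K n x := V'.[x] * (V.[x] * flat (2 * d n) 1 V.[x]).
pose dK n x := (deriv V').[x] * (V.[x] * flat (2 * d n) 1 V.[x]) + V'.[x] *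
  (V'.[x] * flat (2 * d n) 1 V.[x] +
   V.[x] * (flat (2 * d n) (flat_deriv (2 * d n) 1) V.[x] * V'.[x])).
have dV x := is_derive_horner V x.
have dfl n q x := is_derive_comp1 (flat_derive q V.[x] (d20 n)) (dV x).
have dKE n x : is_derive x 1 (K n) (dK n x).
  exact: (is_derive_mul (is_derive_horner V' x) (is_derive_mul (dV x) (dfl n 1 x))).
have cdK n x : {for x, continuous (dK n)}.
  have c2 q : {for x, continuous (fun x => flat (2 * d n) q V.[x])}.
    exact: is_derive_continuous (dfl n q x).
  apply: continuousD; apply: continuousM; try exact: cp.
    by apply: continuousM; [exact: cp|exact: c2].
  apply: continuousD; apply: continuousM; try exact: cp; first exact: c2.
  by apply: continuousM; [exact: c2|exact: cp].
have intK n : \int[mu]_(x in `[a, b]) dK n x = 0.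
  have -> : \int[mu]_(x in `[a, b]) dK n x = K n b - K n a.
    by apply: Rintegral_derive.
  by rewrite /K !flat_le0 ?mulr0 ?subrr// ltW.
pose I n x := derive1 (chi n) x ^+ 2 - 1 / 2 * (U x * chi n x ^+ 2).
pose h n x := I n x - dK n x.
have cI n x : a <= x <= b -> {for x, continuous (I n)}.
  move=> xab; have [dc cc] := test_function_derive (tchi n).
  have c1 := is_derive_continuous (dc x).
  apply: continuousB; first exact: (continuousM (cc x) (cc x)).
  apply: continuousM; first exact: cvg_cst.
  by apply: continuousM; [apply: cU; lra|exact: (continuousM c1 c1)].
have intI n : \int[mu]_(x in `[a, b]) I n x = \int[mu]_(x in `[a, b]) h n x.
  rewrite [RHS]RintegralB//; first by rewrite intK subr0.
  - by apply: continuous_integrable => x /(cI n).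
  - by apply: continuous_integrable => x _; exact: cdK.
have hE n x : a <= x <= b -> h n x =
    if 0 < V.[x] then V'.[x] ^+ 2 * (d n / V.[x] * expR (- (d n / V.[x]))) ^+ 2
                      - g x * V.[x] * expR (- (d n / V.[x])) ^+ 2 else 0.
  move=> xab; rewrite /h /I /dK chiE// dchiE// /g.
  case: ifPn => [Vx|]; last first.
    by rewrite -leNgt => Vx; rewrite !flat_le0//; ring.
  rewrite /flat Vx /flat_deriv -polyC1 derivC !(hornerM, hornerX, hornerD, hornerN, hornerC, horner0).
  have -> : - (2 * d n / V.[x]) = - (d n / V.[x]) * 2%:R by ring.
  by rewrite expRM_natr; field; rewrite gt_eqF.
have hB : exists B, forall n x, a <= x <= b -> `|h n x| <= B.
  have [|B1 H1] := @bounded_on_segment _ (fun x => V'.[x] ^+ 2) a b ab.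
    by move=> x _; exact: (continuousM (cp V' x) (cp V' x)).
  have [|B2 H2] := @bounded_on_segment _ (fun x => g x * V.[x]) a b ab.
    by move=> x xab; apply: continuousM; [apply: cg; lra|exact: cp].
  exists (B1 + B2) => n x xab; rewrite hE//; have b1' := H1 x xab; have b2' := H2 x xab.
  case: ifPn => [Vx|_]; last first.
    by rewrite normr0 (le_trans _ (lerD b1' b2'))// addr_ge0.
  have t0 : 0 <= d n / V.[x] by rewrite divr_ge0 ?ltW.
  move: t0; set t := d n / V.[x] => t0.
  have e1 : expR (- t) <= 1 by rewrite -expR0 ler_expR oppr_le0.
  have te : t * expR (- t) <= 1.
    by rewrite expRN ler_pdivrMr ?expR_gt0// mul1r (le_trans _ (expR_ge1Dx t))// lerDr.
  have E0 := expR_ge0 (- t).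
  apply: (le_trans (ler_normB _ _)); apply: lerD.
  - rewrite normrM (le_trans _ b1')// ler_piMr// ger0_norm ?sqr_ge0//.
    by rewrite expr_le1// mulr_ge0.
  - rewrite normrM (le_trans _ b2')// ler_piMr// ger0_norm ?sqr_ge0//.
    by rewrite expr_le1.
have [B {}hB] := hB.
pose k x := g x * Num.max V.[x] 0.
have hl x : a <= x <= b -> h n x @[n --> \oo] --> - k x.
  move=> xab; under eq_fun do rewrite hE//.
  rewrite /k; case: (ltP 0 V.[x]) => [Vx|Vx]; last first.
    by rewrite mulr0 oppr0; exact: cvg_cst.
  (* The integrand as a function of t = d / V. *)
  pose Phi t := V'.[x] ^+ 2 * (t * expR (- t)) ^+ 2 - g x * V.[x] * expR (- t) ^+ 2.
  have -> : - (g x * V.[x]) = Phi 0.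
    by rewrite /Phi oppr0 expR0 mul0r expr0n expr1n mulr0 sub0r mulr1.
  have ct : (fun n => d n / V.[x]) @ \oo --> (0 : R).
    by rewrite -[0](mul0r V.[x]^-1); apply: cvgMl; exact: cvg_harmonic.
  have dE := is_derive_comp1 (is_derive_expR (- 0)) (is_derive_opp (is_derive_id1 (0 : R))).
  have cPhi : {for (0 : R), continuous Phi} :=
    is_derive_continuous (is_derive_sub
      (is_derive_scale _ (is_derive_exprn 1 (is_derive_mul (is_derive_id1 0) dE)))
      (is_derive_scale _ (is_derive_exprn 1 dE))).
  exact: (continuous_cvg _ cPhi ct).
have [_ cvh] := @Rintegral_bounded_cvg _ h (fun x => - k x) B a b
  (fun n => continuous_integrable (fun x xab => continuousB (cI n x xab) (cdK n x)))
  hB hl.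
have ck x : 0 < x < 1 -> {for x, continuous k}.
  move=> x01; apply: continuousM; first exact: cg.
  by apply: continuous_max; [exact: cp|exact: cvg_cst].
have kpos : 0 < \int[mu]_(x in `[a, b]) k x.
  apply: (Rintegral_gt0 (c := c)) => //.
  - move=> x xab; rewrite mulr_ge0 ?le_max ?lexx ?orbT//.
    by rewrite ltW// gpos.
  - by rewrite mulr_gt0 ?lt_max ?Vc// gpos//; lra.
have kneg : \int[mu]_(x in `[a, b]) (- k x) = - \int[mu]_(x in `[a, b]) k x.
  rewrite -mulN1r -RintegralZl//; last first.
    by apply: continuous_integrable => x xab; apply: ck; lra.
  by apply: eq_Rintegral => x _; rewrite mulN1r.
have Ige0 n : 0 <= \int[mu]_(x in `[a, b]) h n x.
  rewrite -intI -(form_segment cU (tchi n) a0 b1 (out n)) subr_ge0.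
  exact: pos.
have : 0 <= \int[mu]_(x in `[a, b]) (- k x).
  rewrite -(cvg_lim _ cvh)//; apply: limr_ge; first by apply/cvg_ex; eexists; exact: cvh.
  exact: nearW.
by rewrite kneg oppr_ge0 leNgt kpos.
Qed.

End Form_to_disconjugacy.

(** * From the quadratic form to disconjugacy *)

Section Two_zeros.
Variables (R : realType) (U : R -> R).
Hypothesis cU : forall x, 0 < x < 1 -> {for x, continuous U}.
Implicit Types (y z : R -> R) (a b c x : R).

(** By uniqueness a nonzero solution crosses zero transversally, so up to its
    sign it is positive just to the right of a and negative just to the left.
    The third point is taken on the side of b where the solution is negative. *)
Lemma two_zeros_crossing y z a b : hill_pair U y z -> 0 < a < 1 -> 0 < b < 1 ->
  a < b -> y a = 0 -> y b = 0 -> (exists2 x, 0 < x < 1 & y x != 0) ->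
  exists y' z' l c r, [/\ hill_pair U y' z', 0 < l, l < c, c < r & r < 1] /\
    [/\ y' l < 0, 0 < y' c & y' r < 0].
Proof.
move=> h a01 b01 ab ya yb [x0 x01 yx0].
have znz c : 0 < c < 1 -> y c = 0 -> z c != 0.
  move=> c01 yc; apply/eqP => zc; move: yx0.
  by rewrite (hill_unique cU h c01 yc zc x01) eqxx.
have [y' [z' [h' ya' yb' za' zb']]] : exists y' z',
    [/\ hill_pair U y' z', y' a = 0, y' b = 0, 0 < z' a & z' b != 0].
  have [za|za] := ltP 0 (z a); first by exists y, z; split => //; exact: znz.
  exists (fun x => - y x), (fun x => - z x); split.
  - move=> x xx; have [d1 d2] := h x xx; split; first exact: is_derive_opp.
    by apply: (is_derive_congr (is_derive_opp d2)); rewrite mulrN.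
  - by rewrite ya oppr0.
  - by rewrite yb oppr0.
  - by rewrite oppr_gt0 lt_neqAle za znz.
  - by rewrite oppr_eq0 znz.
have sa := increasing_zero_sign (h' a a01).1 za' ya'.
have [l [l0 la [_ /(_ la) yl]]] := near_left (andP a01).1 sa.
have [c [ac cb [/(_ ac) yc _]]] := near_right ab sa.
suff [r [cr r1 yr]] : exists r, [/\ c < r, r < 1 & y' r < 0].
  by exists y', z', l, c, r; split; split => //; lra.
have [zb|zb] := ltP (z' b) 0.
  have zb0 : 0 < - z' b by rewrite oppr_gt0.
  have yb0 : - y' b = 0 by rewrite yb' oppr0.
  have sb := increasing_zero_sign (is_derive_opp (h' b b01).1) zb0 yb0.
  have [r [br r1 [/(_ br) yr _]]] := near_right (andP b01).2 sb.
  by exists r; split => //; [lra|rewrite oppr_gt0 in yr].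
have zb0 : 0 < z' b by rewrite lt_neqAle eq_sym zb' zb.
have sb := increasing_zero_sign (h' b b01).1 zb0 yb'.
have [r [cr rb [_ /(_ rb) yr]]] := near_left cb sb.
by exists r; split => //; lra.
Qed.

(** Weierstrass approximation of the second derivative, integrated twice from c. *)
Lemma approx_C2 (w dw ddw : R -> R) a b c (e : R) : 0 <= a -> b <= 1 -> a <= c <= b ->
  (forall x, a <= x <= b -> is_derive x 1 w (dw x)) ->
  (forall x, a <= x <= b -> is_derive x 1 dw (ddw x)) ->
  (forall x, a <= x <= b -> {for x, continuous ddw}) -> 0 < e ->
  exists V : {poly R}, V.[c] = w c /\ forall x, a <= x <= b ->
    `|V.[x] - w x| <= e /\ `|(deriv (deriv V)).[x] - ddw x| <= e.
Proof.
move=> a0 b1 acb d1 d2 c2 e0.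
(* Clamping extends ddw continuously from [a, b] to the whole line. *)
pose clamp x := Num.min (Num.max x a) b.
have clampE x : a <= x <= b -> clamp x = x.
  by move=> /andP[ax xb]; rewrite /clamp (max_idPl ax) (min_idPl xb).
have clampab x : a <= clamp x <= b.
  by rewrite /clamp ge_min lexx orbT andbT le_min le_max lexx orbT /=; lra.
have cclamp x : {for x, continuous clamp}.
  apply: (@continuous_min _ _ (fun x => Num.max x a) (cst b)); last exact: cvg_cst.
  by apply: (@continuous_max _ _ id (cst a)); [exact: cvg_id|exact: cvg_cst].
have [P HP] := @weierstrass _ (ddw \o clamp) e
  (fun x => continuous_comp (cclamp x) (c2 _ (clampab x))) e0.
have {}HP x : a <= x <= b -> `|P.[x] - ddw x| <= e.
  by move=> xab; have := HP x ltac:(lra); rewrite /= clampE.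
pose V1 := antiderivative P + (dw c - (antiderivative P).[c])%:P.
pose V := antiderivative V1 + (w c - (antiderivative V1).[c])%:P.
have dV1 : deriv V1 = P by rewrite derivD derivC addr0 deriv_antiderivative.
have dV : deriv V = V1 by rewrite derivD derivC addr0 deriv_antiderivative.
have small (f df : R -> R) x : f c = 0 -> a <= x <= b ->
    (forall s, a <= s <= b -> is_derive s 1 f (df s)) ->
    (forall s, a <= s <= b -> `|df s| <= e) -> `|f x| <= e.
  move=> fc xab fE fB.
  have seg s : Num.min c x <= s <= Num.max c x -> a <= s <= b.
    by case: (leP c x); lra.
  have := @factorial_growth _ f df e 1 c x 0 fc (fun s hs => fE s (seg s hs)).
  rewrite mul1r expr1 factS fact0 divr1 => H; apply: (le_trans (H _)).
    by move=> s /seg /fB; rewrite ?expr0 ?divr1 ?mulr1.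
  apply: ler_piMr; first exact: ltW.
  by rewrite ler_norml; lra.
have V1c : V1.[c] = dw c by rewrite hornerD hornerC; ring.
have Vc : V.[c] = w c by rewrite hornerD hornerC; ring.
have V1B x : a <= x <= b -> `|V1.[x] - dw x| <= e.
  move=> xab; apply: (small (fun x => V1.[x] - dw x) (fun x => P.[x] - ddw x)) => //.
  - by rewrite V1c subrr.
  - move=> s sab; rewrite -dV1; exact: (is_derive_sub (is_derive_horner V1 s) (d2 s sab)).
exists V; split => // x xab; split; last by rewrite dV dV1 HP.
apply: (small (fun x => V.[x] - w x) (fun x => V1.[x] - dw x)) => //.
- by rewrite Vc subrr.
- move=> s sab; rewrite -dV; exact: (is_derive_sub (is_derive_horner V s) (d1 s sab)).
Qed.

(** A nonzero solution phi with two zeros is changed into a polynomial V that is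
    negative at two points, positive in between and satisfies
    V'' + U V / 2 > 0: one adds a small multiple of exp (k x), k large, and
    approximates the sum. *)
Theorem form_nonneg_disconjugate : hill_form_nonneg U -> disconjugate U.
Proof.
move=> pos y hy ynz [a [b [a01 b01 ab ya yb]]].
have [a' [b' [a'01 b'01 a'b' ya' yb']]] : exists a' b',
    [/\ 0 < a' < 1, 0 < b' < 1, a' < b', y a' = 0 & y b' = 0].
  by move: ab; case: (ltgtP a b) => // ? _; [exists a, b|exists b, a].
have [phi [dphi [l [c [r [[h l0 lc cr r1] [yl yc yr]]]]]]] :=
  two_zeros_crossing (hill_solution_pair hy) a'01 b'01 a'b' ya' yb' ynz.
have [||M0 HM0] := @bounded_on_segment _ U l r; [lra|by move=> x ?; apply: cU; lra|].
pose M := Num.max M0 0.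
have M_ge0 : 0 <= M by rewrite le_max lexx orbT.
have HM x : l <= x <= r -> `|U x| <= M.
  by move=> /HM0 H; rewrite le_max H.
(* With k = 1 + M, the exponential E satisfies E'' + U E / 2 >= E. *)
pose k := 1 + M; pose E x := expR (k * x).
have k1 : 1 <= k by rewrite lerDl.
have E1 x : 0 <= x -> 1 <= E x.
  by move=> x0; rewrite -expR0 ler_expR mulr_ge0//; lra.
have EK x : x <= 1 -> E x <= E 1.
  by move=> x1; rewrite ler_expR ler_wpM2l//; lra.
have dE x : is_derive x 1 E (k * E x).
  apply: (is_derive_congr (is_derive_comp1 (is_derive_expR (k * x))
    (is_derive_scale k (is_derive_id1 x)))).
  by rewrite mulr1 mulrC.
pose m := Num.min (- phi l) (- phi r).
have [m0 ml mr] : [/\ 0 < m, phi l <= - m & phi r <= - m].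
  by rewrite /m; case: (leP (- phi l) (- phi r)); split; lra.
have E10 : 0 < E 1 by exact: expR_gt0.
(* t * E stays below m / 2 on the segment, which preserves the signs at l, r. *)
pose t := m / (2 * E 1).
have t0 : 0 < t by rewrite divr_gt0// mulr_gt0.
have tE x : x <= 1 -> t * E x <= m / 2.
  move=> /EK H; have -> : m / 2 = t * E 1 by rewrite /t; field; rewrite gt_eqF.
  by rewrite ler_wpM2l// ltW.
pose w x := phi x + t * E x.
pose dw x := dphi x + t * (k * E x).
pose ddw x := - (1 / 2 * U x) * phi x + t * (k * (k * E x)).
have d1 x : l <= x <= r -> is_derive x 1 w (dw x).
  move=> xlr; have [p1 _] := h x ltac:(lra).
  exact: is_derive_add p1 (is_derive_scale t (dE x)).
have d2 x : l <= x <= r -> is_derive x 1 dw (ddw x).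
  move=> xlr; have [_ p2] := h x ltac:(lra).
  exact: is_derive_add p2 (is_derive_scale t (is_derive_scale k (dE x))).
have c2 x : l <= x <= r -> {for x, continuous ddw}.
  move=> xlr; have [/is_derive_continuous cphi _] := h x ltac:(lra).
  apply: continuousD.
    apply: continuousM cphi; apply: continuousN.
    by apply: continuousM; [exact: cvg_cst|apply: cU; lra].
  exact: (is_derive_continuous (is_derive_scale t (is_derive_scale k (is_derive_scale k (dE x))))).
pose e := Num.min (t / 2) (m / 4) / k.
have k0 : 0 < k by lra.
have [e0 et em] : [/\ 0 < e, e * k <= t / 2 & e <= m / 4].
  have [t2 m4] : 0 < t / 2 /\ 0 < m / 4 by split; lra.
  have q0 : 0 < Num.min (t / 2) (m / 4) by rewrite lt_min t2 m4.
  rewrite /e; split; first by rewrite divr_gt0.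
    by rewrite divfK ?gt_eqF// ge_min lexx.
  by rewrite ler_pdivrMr// ge_min; apply/orP; right; rewrite ler_peMr// ltW.
have [V [Vc HV]] := approx_C2 (c := c) (ltW l0) (ltW r1) ltac:(lra) d1 d2 c2 e0.
apply: (form_negative (V := V) (c := c) cU l0 r1) pos.
- by rewrite lc.
- have [+ _] := HV l ltac:(lra); rewrite ler_norml /w.
  by have := tE l ltac:(lra); lra.
- by rewrite Vc /w addr_gt0// mulr_gt0// expR_gt0.
- have [+ _] := HV r ltac:(lra); rewrite ler_norml /w.
  by have := tE r ltac:(lra); lra.
- move=> x xlr; have [v0 v2] := HV x xlr; have Ux := HM x xlr.
  have -> : (deriv (deriv V)).[x] + 1 / 2 * U x * V.[x] =
     t * E x * (k ^+ 2 + 1 / 2 * U x) + ((deriv (deriv V)).[x] - ddw x)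
     + 1 / 2 * (U x * (V.[x] - w x)).
    by rewrite /ddw /w; ring.
  have u1 : `|U x * (V.[x] - w x)| <= M * e by rewrite normrM ler_pM.
  have u2 : t <= t * E x * (k ^+ 2 + 1 / 2 * U x).
    have kU : 1 <= k ^+ 2 + 1 / 2 * U x.
      have : 1 + M <= k ^+ 2 by rewrite /k; nra.
      by move: Ux; rewrite ler_norml; lra.
    have Ex : 1 <= E x by apply: E1; lra.
    rewrite -mulrA; apply: ler_peMr; first exact: ltW.
    by apply: (le_trans Ex); apply: ler_peMr => //; lra.
  have u3 : e + M * e <= t / 2 by have -> : e + M * e = e * k by rewrite /k; ring.
  move: u1 v2; rewrite !ler_norml.
  have Me : 0 <= M * e by rewrite mulr_ge0// ltW.
  by lra.
Qed.

End Two_zeros.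

(** * Inverse functions, supports and the Schwarzian derivative *)

Section Inverse.
Variables (R : realType) (A : set R) (g dg : R -> R).
Hypothesis (oA : open A) (iA : is_interval A).
Hypothesis dgE : forall x, A x -> is_derive x 1 g (dg x).
Hypothesis dg0 : forall x, A x -> 0 < dg x.
Implicit Types x y : R.

Let h := 'pinv_(cst 0) A g.

Lemma increasing_on x y : A x -> A y -> x < y -> g x < g y.
Proof.
move=> Ax Ay xy; apply: (derive_gt0_lt xy) => t xty.
  by apply: dgE; exact: iA xty.
by apply: dg0; exact: iA xty.
Qed.

Lemma increasing_on_le x y : A x -> A y -> (g x <= g y) = (x <= y).
Proof.
move=> Ax Ay; apply/idP/idP => [|]; last first.
  by rewrite le_eqVlt => /predU1P[->//|/(increasing_on Ax Ay)/ltW].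
by rewrite !leNgt; apply: contra; exact: increasing_on.
Qed.

Lemma pinv_cancel x : A x -> h (g x) = x.
Proof.
move=> Ax; apply: pinvKV; rewrite ?inE// => u v; rewrite !inE => Au Av guv.
by apply/eqP; rewrite eq_le -(increasing_on_le Au Av) -(increasing_on_le Av Au) guv lexx.
Qed.

Lemma pinv_image y : (g @` A) y -> A (h y) /\ g (h y) = y.
Proof. by move=> [x Ax <-]; rewrite pinv_cancel. Qed.

Lemma image_between x y v : A x -> A y -> g x <= v <= g y -> (g @` A) v.
Proof.
move=> Ax Ay /andP[xv vy].
have xy : x <= y by rewrite -(increasing_on_le Ax Ay) (le_trans xv).
have [||t] := @IVT _ g x y v xy.
- apply: continuous_within => t /=; rewrite in_itv/= => xty.
  by apply: is_derive_continuous (dgE _); exact: iA xty.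
- by rewrite (min_idPl (le_trans xv vy)) (max_idPr (le_trans xv vy)) xv.
- by rewrite in_itv/= => xty gt; exists t => //; exact: iA xty.
Qed.

Lemma image_interval : is_interval (g @` A).
Proof. by move=> _ _ [x Ax <-] [y Ay <-] v; exact: image_between. Qed.

Lemma open_around x : A x -> exists u v, [/\ A u, A v, u < x & x < v].
Proof.
move=> Ax; have nA : nbhs x A by exact: open_nbhs_nbhs.
have [v [xv _ Av]] := near_right (ltac:(lra) : x < x + 1) nA.
have [u [_ ux Au]] := near_left (ltac:(lra) : x - 1 < x) nA.
by exists u, v.
Qed.

Lemma image_open : open (g @` A).
Proof.
rewrite openE => _ [x Ax <-]; have [u [v [Au Av ux xv]]] := open_around Ax.
have /near_segment : g u < g x < g v by rewrite !increasing_on.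
by apply: filterS => y; exact: image_between.
Qed.

Lemma pinv_derive y : (g @` A) y -> is_derive y 1 h (dg (h y))^-1.
Proof.
move=> [x Ax <-]; rewrite pinv_cancel//.
have nA : nbhs x A by exact: open_nbhs_nbhs.
apply: is_derive_inverse (dgE Ax) _; last by rewrite gt_eqF ?dg0.
- by apply: filterS nA => t; exact: pinv_cancel.
- by apply: filterS nA => t /dgE; exact: is_derive_continuous.
Qed.

End Inverse.

Section Support.
Variable R : realType.
Implicit Types (f : R -> R) (A : set R).

(** An open interval is the interior of its closure: near a point of that
    interior there are points of the interval on both sides. *)
Lemma interior_supp f A : open A -> is_interval A ->
  (forall x, A x -> 0 < f x) -> (forall x, ~ A x -> f x = 0) -> (supp f)° = A.
Proof.
move=> oA iA fpos f0.
have -> : supp f = closure A.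
  congr closure; apply/seteqP; split=> x /=.
    by move=> fx; apply: contrapT => /f0 e; rewrite e eqxx in fx.
  by move=> /fpos; rewrite lt0r => /andP[].
apply/seteqP; split=> x; last first.
  move=> Ax; rewrite /interior; apply: filterS (@subset_closure _ A) _.
  exact: open_nbhs_nbhs.
rewrite /interior => /nbhs_ballP[e /= e0 He].
have pt y : `|x - y| < e -> exists2 t, A t & `|y - t| < e / 2.
  move=> xy; have /He cy : ball x e y by [].
  have [t [At yt]] := cy _ (nbhsx_ballx y (e / 2) (ltac:(by rewrite divr_gt0))).
  by exists t.
have [t At ht] := pt (x - e / 2) ltac:(by rewrite gtr0_norm; lra).
have [u Au hu] := pt (x + e / 2) ltac:(by rewrite ltr0_norm; lra).
apply: (iA t u) => //; move: ht hu; rewrite !ltr_norml; lra.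
Qed.

End Support.

Section Schwarzian.
Variable R : realType.
Implicit Types (g psi dpsi ddpsi : R -> R) (x : R) (A : set R).

Lemma derive1n_chain (fs : nat -> R -> R) A n : open A ->
  (forall j, (j < n)%N -> forall x, A x -> is_derive x 1 (fs j) (fs j.+1 x)) ->
  forall j, (j <= n)%N -> forall x, A x -> derive1n j (fs 0%N) x = fs j x.
Proof.
move=> oA D; elim=> [//|j IH] jn x Ax.
rewrite derive1nS derive1E; have [_ <-] := D j jn x Ax.
apply: near_eq_derive; have : nbhs x A by exact: open_nbhs_nbhs.
by apply: filterS => t; apply: IH; exact: ltnW.
Qed.

(** The classical link between the Schwarzian derivative and linear second order
    equations. *)
Lemma schwarzian_inv_sqr g psi dpsi ddpsi A : open A ->
  (forall x, A x -> is_derive x 1 g (psi x ^+ 2)^-1) ->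
  (forall x, A x -> 0 < psi x) ->
  (forall x, A x -> is_derive x 1 psi (dpsi x)) ->
  (forall x, A x -> is_derive x 1 dpsi (ddpsi x)) ->
  forall x, A x -> schwarzian g x = - 2 * (ddpsi x / psi x).
Proof.
move=> oA dg p0 d1 d2 x Ax.
pose q1 x := (psi x ^+ 2)^-1.
pose q2 x := -2 * (dpsi x * (psi x ^+ 3)^-1).
pose q3 x := -2 * (ddpsi x * (psi x ^+ 3)^-1 - 3 * (dpsi x ^+ 2 * (psi x ^+ 4)^-1)).
pose fs j := nth g [:: g; q1; q2; q3] j.
have pn t : A t -> psi t != 0 by move=> /p0 ?; rewrite gt_eqF.
have D j : (j < 3)%N -> forall t, A t -> is_derive t 1 (fs j) (fs j.+1 t).
  case: j => [|[|[|//]]] _ t At /=; first exact: dg.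
  - apply: (is_derive_congr (is_derive_inv _ (is_derive_exprn 1 (d1 t At)))).
      by rewrite expf_neq0 ?pn.
    by rewrite /fs /= /q2; field; exact: pn.
  - have p3 : psi t ^+ 3 != 0 by rewrite expf_neq0 ?pn.
    rewrite -[fs 2%N]/q2 -[fs 3%N t]/(q3 t) /q2.
    have di := @is_derive_inv _ (fun t => psi t ^+ 3) t _ p3 (is_derive_exprn 2 (d1 t At)).
    apply: (is_derive_congr (is_derive_scale (-2) (is_derive_mul (d2 t At) di))).
    by rewrite /q3; field; exact: pn.
have E j jn := derive1n_chain oA D (j := j) jn Ax.
have e1 : derive1 g x = q1 x := E 1%N isT.
have e2 : derive1n 2 g x = q2 x := E 2%N isT.
have e3 : derive1n 3 g x = q3 x := E 3%N isT.
rewrite /schwarzian e3 e2 e1 /q1 /q2 /q3.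
by field; exact: pn.
Qed.

End Schwarzian.

(** * The law reconstructed from a positive solution *)

Section Reconstruction.
Variables (R : realType) (U psi : R -> R) (z0 : R).
Hypothesis psi_sol : positive_hill_solution U psi.
Hypothesis z001 : 0 < z0 < 1.
Notation mu := (@lebesgue_measure R).
Implicit Types x z a b : R.

Let A : set R := `]0, 1[%classic.
Let Q := recQ psi z0.
Let F := recF psi z0.
Let J := recJ psi z0.
Let f := recf psi z0.
Let dQ x := (psi x ^+ 2)^-1.

Let AE x : A x <-> 0 < x < 1. Proof. by rewrite /A /= in_itv. Qed.
Let oA : open A. Proof. exact: interval_open. Qed.
Let iA : is_interval A. Proof. exact: interval_is_interval. Qed.

Let psi0 x : A x -> 0 < psi x. Proof. by move=> /AE; exact: psi_sol.2. Qed.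
Let psi1 x : A x -> is_derive x 1 psi (derive1 psi x).
Proof. by have [d _ _] := Ck_on2E psi_sol.1.1; move=> /d. Qed.
Let psi2 x : A x -> is_derive x 1 (derive1 psi) (derive1n 2 psi x).
Proof. by have [_ d _] := Ck_on2E psi_sol.1.1; move=> /d. Qed.
Let psi2c x : A x -> {for x, continuous (derive1n 2 psi)}.
Proof. by have [_ _ c] := Ck_on2E psi_sol.1.1; move=> /c. Qed.

Lemma recQ_derive x : A x -> is_derive x 1 Q (dQ x).
Proof.
move=> /AE x01; apply: oriented_integral_derive x01 => // t /AE At.
have /is_derive_continuous ct := psi1 At.
by apply: continuousV; [rewrite expf_neq0// gt_eqF ?psi0|exact: (continuousM ct ct)].
Qed.

Let dQ0 x : A x -> 0 < dQ x.
Proof. by move=> /psi0 p; rewrite invr_gt0 exprn_gt0. Qed.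

Lemma recJ_open : open J. Proof. exact: (image_open oA iA recQ_derive dQ0). Qed.

Lemma recJ_interval : is_interval J.
Proof. exact: (image_interval iA recQ_derive dQ0). Qed.

Lemma recFK x : A x -> F (Q x) = x.
Proof. exact: (pinv_cancel iA recQ_derive dQ0). Qed.

Lemma recF_image y : J y -> A (F y) /\ Q (F y) = y.
Proof. exact: (pinv_image iA recQ_derive dQ0). Qed.

Lemma recf_in y : J y -> f y = psi (F y) ^+ 2.
Proof. by move=> Jy; rewrite /f /recf /patch mem_set. Qed.

Lemma recf_out y : ~ J y -> f y = 0.
Proof. by move=> Jy; rewrite /f /recf /patch memNset. Qed.

Lemma recf_gt0 y : J y -> 0 < f y.
Proof. by move=> Jy; rewrite recf_in// exprn_gt0// psi0//; have [] := recF_image Jy. Qed.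

Lemma recf_ge0 y : 0 <= f y.
Proof. by have [/recf_gt0/ltW//|/recf_out->] := pselect (J y). Qed.

Lemma recF_derive y : J y -> is_derive y 1 F (f y).
Proof.
move=> Jy; rewrite recf_in// -[psi _ ^+ 2]invrK.
exact: (pinv_derive oA iA recQ_derive dQ0 Jy).
Qed.

(** On J, f = psi ^+ 2 \o F and F' = f, so that each derivative of f is again an
    expression in psi and its derivatives at F. *)
Lemma recf_Ck2 : Ck_on 2 J f.
Proof.
pose p y := psi (F y); pose r y := derive1 psi (F y).
have dF y (Jy : J y) : is_derive y 1 F (p y ^+ 2).
  by rewrite /p -recf_in//; exact: recF_derive.
have dp y (Jy : J y) : is_derive y 1 p (r y * p y ^+ 2).
  exact: is_derive_comp1 (psi1 (recF_image Jy).1) (dF y Jy).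
have dr y (Jy : J y) : is_derive y 1 r (derive1n 2 psi (F y) * p y ^+ 2).
  exact: is_derive_comp1 (psi2 (recF_image Jy).1) (dF y Jy).
have [|y Jy|y Jy|y Jy|//] := @Ck_on2I R f (fun y => 2 * (p y ^+ 3 * r y))
  (fun y => 2 * (3 * p y ^+ 2 * (r y * p y ^+ 2) * r y +
                 p y ^+ 3 * (derive1n 2 psi (F y) * p y ^+ 2))) J.
- exact: recJ_open.
- apply: (@near_eq_is_derive R R R (fun y => p y ^+ 2)).
    have : nbhs y J by apply: open_nbhs_nbhs; split; [exact: recJ_open|].
    by apply: filterS => t /recf_in.
  by apply: (is_derive_congr (is_derive_exprn 1 (dp y Jy))); ring.
- exact: (is_derive_scale 2 (is_derive_mul (is_derive_exprn 2 (dp y Jy)) (dr y Jy))).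
- have cp := is_derive_continuous (dp y Jy); have cr := is_derive_continuous (dr y Jy).
  have cX n : {for y, continuous (fun y => p y ^+ n.+1)}.
    exact: is_derive_continuous (is_derive_exprn n (dp y Jy)).
  have cdd : {for y, continuous (fun y => derive1n 2 psi (F y))}.
    apply: (continuous_comp (is_derive_continuous (dF y Jy))).
    exact: psi2c (recF_image Jy).1.
  have cst (k : R) : {for y, continuous (fun=> k)} by exact: cvg_cst.
  exact: (continuousM (cst 2) (continuousD
    (continuousM (continuousM (continuousM (cst 3) (cX 1%N)) (continuousM cr (cX 1%N))) cr)
    (continuousM (cX 2%N) (continuousM cdd (cX 1%N))))).
Qed.

Lemma recf_continuous y : J y -> {for y, continuous f}.
Proof.
have [d _ _] := Ck_on2E recf_Ck2; move=> /d; exact: is_derive_continuous.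
Qed.

Lemma recf_supp : (supp f)° = J.
Proof.
apply: interior_supp; [exact: recJ_open|exact: recJ_interval|exact: recf_gt0|].
exact: recf_out.
Qed.

Let mJ : measurable J.
Proof. by apply: open_measurable; exact: recJ_open. Qed.

Lemma recf_measurable : measurable_fun [set: R] f.
Proof.
apply/(measurable_restrictT _ mJ).
apply: (@eq_measurable_fun _ _ _ _ _ f); first by move=> x; rewrite inE => /recf_in.
apply: open_continuous_measurable_fun; first exact: recJ_open.
by move=> x; rewrite inE; exact: recf_continuous.
Qed.

Lemma recf_segment a b : 0 < a -> a <= b -> b < 1 ->
  (\int[mu]_(x in `[Q a, Q b]) (f x)%:E = (b - a)%:E)%E.
Proof.
move=> a0 ab b1; have [Aa Ab] : A a /\ A b by rewrite !AE; lra.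
have QJ x : Q a <= x <= Q b -> J x.
  by apply: recJ_interval; [exists a|exists b].
have Qab : Q a <= Q b by rewrite (increasing_on_le iA recQ_derive dQ0).
have cf x : Q a <= x <= Q b -> {for x, continuous f}.
  by move=> /QJ; exact: recf_continuous.
have iQ := continuous_integrable cf.
have -> : b - a = \int[mu]_(x in `[Q a, Q b]) f x.
  rewrite -{1}(recFK Ab) -{1}(recFK Aa); apply/esym.
  by apply: Rintegral_derive => // x /QJ; exact: recF_derive.
by rewrite /Rintegral fineK//; exact: integrable_fin_num.
Qed.

(** The segments [Q (u n), Q (v n)] have mass v n - u n, as F is an antiderivative
    of f; monotone convergence gives the mass of the set that they exhaust. *)
Lemma recf_exhaustion (u v : nat -> R) (D : set R) (l : R) :
  (forall n, 0 < u n /\ u n <= v n /\ v n < 1) ->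
  (forall n, u n.+1 <= u n) -> (forall n, v n <= v n.+1) ->
  (forall x, J x -> D x <-> exists n, u n <= F x <= v n) ->
  v n - u n @[n --> \oo] --> l ->
  (\int[mu]_(x in D) (f x)%:E = l%:E)%E.
Proof.
move=> uv du iv DE vul.
pose E n : set R := `[Q (u n), Q (v n)]%classic.
have Auv n : A (u n) /\ A (v n) by rewrite !AE; have := uv n; lra.
have EJ n x : E n x <-> J x /\ u n <= F x <= v n.
  have [Au Av] := Auv n; rewrite /E /= in_itv/=; split.
    move=> h; have Jx : J x.
      by apply: recJ_interval h; [exists (u n)|exists (v n)].
    split=> //; have [AF e] := recF_image Jx.
    by rewrite -e !(increasing_on_le iA recQ_derive dQ0) in h.
  move=> [Jx h]; have [AF e] := recF_image Jx.
  by rewrite -e !(increasing_on_le iA recQ_derive dQ0).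
have -> : (\int[mu]_(x in D) (f x)%:E = \int[mu]_(x in \bigcup_n E n) (f x)%:E)%E.
  rewrite integral_mkcond [RHS]integral_mkcond; apply: eq_integral => x _.
  rewrite !patchE; have [Jx|nJx] := pselect (J x); last first.
    by rewrite recf_out// !if_same.
  have -> : (x \in \bigcup_n E n) = (x \in D) => //.
  apply/idP/idP; rewrite !inE.
    by move=> [n _ /EJ[_ h]]; apply/DE => //; exists n.
  by move=> /(DE _ Jx)[n h]; exists n => //; apply/EJ.
have c : (\int[mu]_(x in E n) (f x)%:E @[n --> \oo] -->
          \int[mu]_(x in \bigcup_n E n) (f x)%:E)%E.
  apply: ge0_nondecreasing_set_cvg_integral.
  - apply/nondecreasing_seqP => n; rewrite subsetEset => x /EJ[Jx h]; apply/EJ.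
    by split=> //; have := du n; have := iv n; lra.
  - by move=> n; exact: measurable_itv.
  - by move=> n; apply/measurable_EFinP; apply: measurable_funTS; exact: recf_measurable.
  - by move=> n x _; rewrite lee_fin recf_ge0.
have c' : (\int[mu]_(x in E n) (f x)%:E @[n --> \oo] --> l%:E)%E.
  have -> : (fun n => \int[mu]_(x in E n) (f x)%:E)%E = (fun n => (v n - u n)%:E).
    by apply/funext => n; rewrite recf_segment//; have := uv n; lra.
  by apply: cvg_EFin => //; exact: nearW.
exact: (cvg_unique _ c c').
Qed.

Lemma recf_mass : (\int[mu]_x (f x)%:E = 1)%E.
Proof.
(* The index is shifted by 2 so that h n <= 1 - h n from the start. *)
pose h n : R := n.+2%:R^-1.
have h0 n : 0 < h n by rewrite invr_gt0.
have h2 n : h n <= 2^-1 by rewrite lef_pV2 ?posrE// ler_nat.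
have hd n : h n.+1 <= h n by rewrite lef_pV2 ?posrE// ler_nat.
have ch : h n @[n --> \oo] --> (0 : R).
  by have := @cvg_harmonic R; rewrite -(@cvg_shiftS _ (@harmonic R)).
apply: (@recf_exhaustion h (fun n => 1 - h n)).
- by move=> n; have := h0 n; have := h2 n; lra.
- exact: hd.
- by move=> n; have := hd n; lra.
- move=> x Jx; split=> // _; have [/AE x01 _] := recF_image Jx.
  have : \forall n \near \oo, h n < Num.min (F x) (1 - F x).
    by apply: (cvgr_lt _ ch); rewrite lt_min; lra.
  move=> [n _ /(_ n (leqnn n))]; rewrite /= lt_min => hn; exists n; lra.
- rewrite -[X in _ --> X](_ : 1 - 0 - 0 = 1); last by rewrite !subr0.
  by apply: cvgB => //; apply: cvgB => //; exact: cvg_cst.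
Qed.

Lemma recf_distr y : J y -> distr_fun f y = F y.
Proof.
move=> Jy; have [/AE z01 e] := recF_image Jy.
pose h n : R := F y / n.+2%:R.
have h0 n : 0 < h n by rewrite divr_gt0//; lra.
have ch : h n @[n --> \oo] --> (0 : R).
  have := @cvg_harmonic R; rewrite -(@cvg_shiftS _ (@harmonic R)) => c.
  by rewrite -(mulr0 (F y)); apply: cvgMr c.
rewrite /distr_fun /Rintegral (@recf_exhaustion h (fun=> F y) _ (F y))//.
- move=> n; split => //; split; last by lra.
  by rewrite ler_pdivrMr// ler_peMr ?ler1n//; lra.
- by move=> n; rewrite ler_wpM2l ?lef_pV2 ?posrE ?ler_nat//; lra.
- move=> x Jx; have [/AE x01 ex] := recF_image Jx; rewrite /= in_itv/=.
  have -> : (x <= y) = (F x <= F y).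
    by rewrite -[RHS](increasing_on_le iA recQ_derive dQ0) ?AE// ex e.
  split=> [xy|[n /andP[]]//].
  have : \forall n \near \oo, h n < F x by apply: (cvgr_lt _ ch); lra.
  by move=> [n _ /(_ n (leqnn n))] /= hn; exists n; rewrite ltW.
- rewrite -[X in _ --> X]subr0; apply: cvgB => //; exact: cvg_cst.
Qed.

Lemma recf_quantile z : A z -> quantile f z = Q z.
Proof.
move=> Az; rewrite /quantile recf_supp.
have JQ : J (Q z) by exists z.
have dD x : J x -> is_derive x 1 (distr_fun f) (f x).
  move=> Jx; apply: near_eq_is_derive (recF_derive Jx).
  have : nbhs x J by apply: open_nbhs_nbhs; split; [exact: recJ_open|].
  by apply: filterS => t /recf_distr.
have := pinv_cancel recJ_interval dD recf_gt0 JQ.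
by rewrite recf_distr// recFK.
Qed.

Lemma recf_Dplus2 : Dplus2 f.
Proof.
split; last by rewrite recf_supp; exact: recf_Ck2.
split; first by split; [exact: recf_measurable|exact: recf_ge0|exact: recf_mass].
exists J; split; [exact: recJ_open|exact: recJ_interval| |exact: recf_gt0|exact: recf_out].
by move=> x; rewrite inE; exact: recf_continuous.
Qed.

Lemma recf_potential : has_potential f U.
Proof.
move=> z /AE Az.
have dq x : A x -> is_derive x 1 (quantile f) (dQ x).
  move=> Ax; apply: near_eq_is_derive (recQ_derive Ax).
  have : nbhs x A by apply: open_nbhs_nbhs.
  by apply: filterS => t /recf_quantile.
rewrite /potential (schwarzian_inv_sqr oA dq psi0 psi1 psi2 Az).
have := psi_sol.1.2 z ((AE z).1 Az); have p0 : psi z != 0 by rewrite gt_eqF// psi0.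
move=> /eqP; rewrite addr_eq0 => /eqP->; field; exact: p0.
Qed.

End Reconstruction.

(** * The positive solution attached to a law *)

Section Law.
Variables (R : realType) (f : R -> R).
Hypothesis f_law : Dplus2 f.
Notation mu := (@lebesgue_measure R).
Implicit Types x z a b : R.

Let D := distr_fun f.
Let I := (supp f)°.
Let q := quantile f.

Let f0 x : 0 <= f x. Proof. by have [[[]]] := f_law. Qed.

Let I_spec : [/\ open I, is_interval I, forall x, I x -> 0 < f x
  & forall x, ~ I x -> f x = 0].
Proof.
have [[_ [A [oA iA _ fA f0A]]] _] := f_law.
by rewrite /I (interior_supp oA iA fA f0A).
Qed.

Let oI : open I. Proof. by have [] := I_spec. Qed.
Let iI : is_interval I. Proof. by have [] := I_spec. Qed.
Let fpos x : I x -> 0 < f x. Proof. by have [_ _ p _] := I_spec; move=> /p. Qed.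
Let fout x : ~ I x -> f x = 0. Proof. by have [_ _ _ p] := I_spec; move=> /p. Qed.

Let f1 x : I x -> is_derive x 1 f (derive1 f x).
Proof. by have [d _ _] := Ck_on2E f_law.2; move=> /d. Qed.
Let f2 x : I x -> is_derive x 1 (derive1 f) (derive1n 2 f x).
Proof. by have [_ d _] := Ck_on2E f_law.2; move=> /d. Qed.

Let f_integrable : mu.-integrable [set: R] (EFin \o f).
Proof.
have [[[mf _ mass] _] _] := f_law.
apply/integrableP; split; first exact/measurable_EFinP.
under eq_integral do rewrite /= ger0_norm//.
by rewrite mass ltry.
Qed.

Let f_integrable_itv (i : interval R) : mu.-integrable [set` i] (EFin \o f).
Proof. exact: integrableS f_integrable. Qed.

Lemma distr_fun_sub a b : a <= b ->
  D b - D a = \int[mu]_(x in `]a, b]) f x.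
Proof. by move=> ab; rewrite /D /distr_fun Rintegral_itvB ?bnd_simp. Qed.

Lemma distr_fun_ge0 x : 0 <= D x.
Proof. by apply: Rintegral_ge0. Qed.

Lemma distr_fun_le1 x : D x <= 1.
Proof.
have [[[mf _ mass] _] _] := f_law.
rewrite -lee_fin /D /distr_fun /Rintegral fineK; last exact: integrable_fin_num.
rewrite -mass; apply: ge0_subset_integral => //.
- exact/measurable_EFinP.
- by move=> t _; rewrite lee_fin.
Qed.

Lemma distr_fun_exhaust e : 0 < e -> exists a b, a <= b /\ 1 - e < D b - D a.
Proof.
move=> e0; have [[[mf _ mass] _] _] := f_law.
pose E n : set R := `]- n%:R, n%:R]%classic.
have EU : \bigcup_n E n = [set: R].
  apply/seteqP; split => // x _; exists (Num.truncn `|x|).+1 => //.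
  rewrite /E /= in_itv/=; have := truncnS_gt `|x|.
  by rewrite ltr_norml => /andP[-> /ltW ->].
have c : (\int[mu]_(x in E n) (f x)%:E @[n --> \oo] -->
          \int[mu]_(x in \bigcup_n E n) (f x)%:E)%E.
  apply: ge0_nondecreasing_set_cvg_integral.
  - apply/nondecreasing_seqP => n; rewrite subsetEset => x.
    by rewrite /E /= !in_itv/= -natr1; lra.
  - by move=> n; exact: measurable_itv.
  - by move=> n; apply/measurable_EFinP; exact: measurable_funTS.
  - by move=> n x _; rewrite lee_fin.
rewrite EU mass in c.
have {}c : D n%:R - D (- n%:R) @[n --> \oo] --> (1 : R).
  have -> : (fun n : nat => D n%:R - D (- n%:R)) =
      fine \o (fun n => \int[mu]_(x in E n) (f x)%:E)%E; last exact: fine_cvg.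
  apply/funext => n /=.
  by rewrite distr_fun_sub// lerNl (le_trans _ (ler0n _ n))// oppr_le0.
have e1 : 1 - e < 1 by lra.
have [n _ /(_ n (leqnn n)) hn] := cvgr_gt _ c _ e1.
exists (- n%:R), n%:R; split => //.
by rewrite lerNl (le_trans _ (ler0n _ n))// oppr_le0.
Qed.

Lemma distr_fun_derive x : I x -> is_derive x 1 D (f x).
Proof.
move=> Ix; have x1 : x < x + 1 by lra.
have [||dD eD] := @continuous_FTC1 R f -oo%O x (x + 1) x1 (f_integrable_itv _).
- by rewrite /= ltNyr.
- exact: is_derive_continuous (f1 Ix).
by rewrite -eD derive1E; exact: derivableP.
Qed.

Lemma distr_fun_in01 x : I x -> 0 < D x < 1.
Proof.
move=> Ix; have [u [v [Iu Iv ux xv]]] := open_around oI Ix.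
have h1 := increasing_on iI distr_fun_derive fpos Iu Ix ux.
have h2 := increasing_on iI distr_fun_derive fpos Ix Iv xv.
by have := distr_fun_ge0 u; have := distr_fun_le1 v; lra.
Qed.

(** D takes the value z by the intermediate value theorem on the whole line. A
    point c outside of I lies to the left or to the right of I, so that D is
    constant between c and one of the points a, b, where D a < z < D b. *)
Lemma distr_fun_surj z : 0 < z < 1 -> exists2 x, I x & D x = z.
Proof.
move=> z01; pose e := Num.min z (1 - z).
have [e0 ez e1z] : [/\ 0 < e, e <= z & e <= 1 - z].
  by rewrite /e; case: (leP z (1 - z)); split; lra.
have [a [b [ab hab]]] := distr_fun_exhaust e0.
have Daz : D a < z by have := distr_fun_le1 b; lra.
have Dbz : z < D b by have := distr_fun_ge0 a; lra.
pose P x := parameterized_integral mu a x f.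
have PE x : a <= x -> P x = D x - D a.
  move=> ax; rewrite /P /parameterized_integral.
  rewrite -Rintegral_itv_obnd_cbnd; last exact: f_integrable_itv.
  by rewrite -distr_fun_sub.
have [||c] := @IVT _ P a b (z - D a) ab.
- exact: parameterized_integral_continuous ab (f_integrable_itv `[a, b]%R).
- rewrite !PE// subrr ge_min le_max subr_ge0 subr_le0 !lerD2r.
  by rewrite (ltW Daz) (ltW Dbz) orbT.
rewrite in_itv/= => /andP[ac cb]; rewrite PE// => /addIr Dc.
exists c => //; apply: contrapT => nIc.
have cst_out u v : u <= v -> (forall t, u < t -> t <= v -> ~ I t) -> D v = D u.
  move=> uv out; apply/eqP; rewrite -subr_eq0 distr_fun_sub// /Rintegral.
  rewrite integral0_eq// => t /=; rewrite in_itv/= => /andP[ut tv].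
  by rewrite fout//; exact: out.
have [[i [Ii ic]]|noleft] := pselect (exists i, I i /\ i < c).
  suff : D b = D c by lra.
  apply: cst_out => // t ct _ It; apply: nIc; apply: (iI Ii It); lra.
suff : D c = D a by lra.
apply: cst_out => // t _ tc It.
have [tc'|tc'] : t = c \/ t < c by case: (ltgtP t c) tc => // ? _; [right|left].
  by apply: nIc; rewrite -tc'.
by apply: noleft; exists t.
Qed.

Let image01 z : 0 < z < 1 -> (D @` I) z.
Proof. by move=> /distr_fun_surj[x Ix <-]; exists x. Qed.

Let qI z : 0 < z < 1 -> I (q z) /\ D (q z) = z.
Proof. by move=> /image01; exact: (pinv_image iI distr_fun_derive fpos). Qed.

Let qK x : I x -> q (D x) = x.
Proof. exact: (pinv_cancel iI distr_fun_derive fpos). Qed.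

Let q_derive z : 0 < z < 1 -> is_derive z 1 q (f (q z))^-1.
Proof. by move=> /image01; exact: (pinv_derive oI iI distr_fun_derive fpos). Qed.

Let psi z := Num.sqrt (f (q z)).

Let psi_sqr z : psi z ^+ 2 = f (q z).
Proof. by rewrite sqr_sqrtr. Qed.

Let psi_gt0 z : 0 < z < 1 -> 0 < psi z.
Proof. by move=> /qI[/fpos ? _]; rewrite sqrtr_gt0. Qed.

Variable U : R -> R.
Hypothesis cU : forall x, 0 < x < 1 -> {for x, continuous U}.
Hypothesis fU : has_potential f U.

Lemma law_hill_solution : positive_hill_solution U psi.
Proof.
split; last exact: psi_gt0.
pose r z := derive1 f (q z).
pose dpsi z := r z * (2 * psi z ^+ 3)^-1.
have dq z (z01 : 0 < z < 1) : is_derive z 1 q (psi z ^+ 2)^-1.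
  by rewrite psi_sqr; exact: q_derive.
have p0 z (z01 : 0 < z < 1) : psi z != 0 by rewrite gt_eqF// psi_gt0.
have d1 z (z01 : 0 < z < 1) : is_derive z 1 psi (dpsi z).
  have [Iq _] := qI z01.
  apply: (is_derive_congr (is_derive_comp1 (is_derive1_sqrt (fpos Iq))
    (is_derive_comp1 (f1 Iq) (dq z z01)))).
  by rewrite -/(psi z) /dpsi /r; field; exact: p0.
have d2 z (z01 : 0 < z < 1) : exists l, is_derive z 1 dpsi l.
  have [Iq _] := qI z01; eexists.
  apply: (is_derive_mul (is_derive_comp1 (f2 Iq) (dq z z01))).
  apply: (@is_derive_inv _ (fun z => 2 * psi z ^+ 3)).
    by rewrite mulf_neq0 ?pnatr_eq0 ?expf_neq0 ?p0.
  exact: (is_derive_scale 2 (is_derive_exprn 2 (d1 z z01))).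
have {}d2 z (z01 : 0 < z < 1) : is_derive z 1 dpsi (derive1 dpsi z).
  by have [l dl] := d2 z z01; rewrite derive1E; apply: derivableP; case: dl.
apply: (pair_hill_solution cU (z := dpsi)) => z z01; split; first exact: d1.
apply: (is_derive_congr (d2 z z01)).
rewrite fU// /potential.
pose A : set R := `]0, 1[%classic.
have AE (t : R) : A t -> 0 < t < 1 by rewrite /A /= in_itv.
have oA : open A by exact: interval_open.
have Az : A z by rewrite /A /= in_itv.
rewrite (schwarzian_inv_sqr oA (fun t At => dq t (AE t At))
  (fun t At => psi_gt0 (AE t At)) (fun t At => d1 t (AE t At))
  (fun t At => d2 t (AE t At)) Az).
by field; exact: p0.
Qed.

Let law_recQ z0 z : 0 < z0 < 1 -> 0 < z < 1 -> recQ psi z0 z = q z - q z0.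
Proof.
move=> z001 z01.
have AE (t : R) : `]0, 1[%classic t <-> 0 < t < 1 by rewrite /= in_itv.
have H : recQ psi z0 z - q z = recQ psi z0 z0 - q z0.
  apply: (@derive0_cst _ (fun t => recQ psi z0 t - q t) `]0, 1[); rewrite ?AE//.
    exact: interval_is_interval.
  move=> t At; have dR := recQ_derive law_hill_solution z001 At.
  apply: (is_derive_congr (is_derive_sub dR (q_derive ((AE t).1 At)))).
  by rewrite psi_sqr subrr.
have := H; rewrite [recQ psi z0 z0]oriented_integral_refl; lra.
Qed.

Let law_recf z0 x : 0 < z0 < 1 -> f x = recf psi z0 (x - q z0).
Proof.
move=> z001; have psol := law_hill_solution.
have [Ix|nIx] := pselect (I x).
  have D01 := distr_fun_in01 Ix.
  have A : `]0, 1[%classic (D x) by rewrite /= in_itv.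
  have xE : x - q z0 = recQ psi z0 (D x) by rewrite law_recQ// qK.
  rewrite recf_in; last by exists (D x).
  by rewrite xE (recFK psol z001 A) psi_sqr qK.
rewrite fout// recf_out// => -[z /=]; rewrite in_itv/= => z01.
rewrite law_recQ// => /eqP; rewrite (inj_eq (addIr _)) => /eqP qz.
by apply: nIx; rewrite -qz; have [] := qI z01.
Qed.

(** Any base point z0 works with the shift c = q z0; the condition on f 0 asks
    for the base point D 0, whose quantile is 0. *)
Lemma law_reconstruction : exists psi z0 c,
  [/\ positive_hill_solution U psi, 0 < z0 < 1,
      forall x, f x = recf psi z0 (x - c) & 0 < f 0 -> c = 0].
Proof.
have psol := law_hill_solution.
have [I0|nI0] := pselect (I 0).
  exists psi, (D 0), (q (D 0)); split => //; first exact: distr_fun_in01.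
  - by move=> x; apply: law_recf; exact: distr_fun_in01.
  - by move=> _; exact: qK.
have h01 : 0 < (2^-1 : R) < 1 by lra.
exists psi, 2^-1, (q 2^-1); split => //; first by move=> x; exact: law_recf.
by rewrite fout// ltxx.
Qed.

End Law.

(** * The equivalence *)

Theorem theorem16 (R : realType) (U : R -> R)
    (hU : {in `]0, 1[%classic, continuous U}) :
  [/\ (exists f, Dplus2 f /\ has_potential f U) <->
      (exists psi, positive_hill_solution U psi),
      (exists psi, positive_hill_solution U psi) <-> disconjugate U,
      disconjugate U <-> hill_form_nonneg U
    & probability_cone U ->
      (forall psi z0, positive_hill_solution U psi -> 0 < z0 < 1 ->
         [/\ Dplus2 (recf psi z0),
             has_potential (recf psi z0) U,
             forall z, 0 < z < 1 ->
               quantile (recf psi z0) z = recQ psi z0 z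
           & forall x, recJ psi z0 x ->
               distr_fun (recf psi z0) x = recF psi z0 x])
      /\
      (forall f, Dplus2 f -> has_potential f U ->
         exists psi z0 c,
           [/\ positive_hill_solution U psi, 0 < z0 < 1,
               forall x, f x = recf psi z0 (x - c)
             & 0 < f 0 -> c = 0])].
Proof.
have cU x : 0 < x < 1 -> {for x, continuous U}.
  by move=> x01; apply: hU; rewrite inE /= in_itv.
have pos_form : (exists psi, positive_hill_solution U psi) -> hill_form_nonneg U.
  by move=> [psi]; exact: positive_form_nonneg.
have form_dis := form_nonneg_disconjugate cU.
have dis_pos := disconjugate_positive cU.
split.
- split=> [[f [lf fU]]|[psi psol]].
    by exists (fun z => Num.sqrt (f (quantile f z))); exact: law_hill_solution.
  have h01 : 0 < (2^-1 : R) < 1 by lra.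
  exists (recf psi 2^-1); split; first exact: recf_Dplus2 psol h01.
  exact: recf_potential.
- by split=> [/pos_form/form_dis|].
- by split=> [/dis_pos/pos_form|].
move=> _; split=> [psi z0 psol z001|f lf fU]; last exact: law_reconstruction.
split; [exact: recf_Dplus2 psol z001|exact: recf_potential| |].
- by move=> z z01; apply: recf_quantile psol z001 _ _; rewrite /= in_itv.
- by move=> x; exact: recf_distr psol z001 x.
Qed.
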